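(* Let $k,\ell\ge 1$ be integers, let $n=k+\ell+1$, and let $f_1,f_2:\mathbb{R}\to\mathbb{R}$ be smooth $T$-periodic functions (for some $T>0$) with $f_2>0$ and $f_1^2+f_2^2<1$. Put $f=\sqrt{1-f_1^2-f_2^2}>0$, and suppose that $$\phi:\mathbb{S}^k\times\mathbb{S}^\ell\times\mathbb{S}^1\to\mathbb{S}^{n+1}\subset\mathbb{R}^{k+1}\times\mathbb{R}^{\ell+1}\times\mathbb{R},\qquad \phi(y,z,t)=\bigl(f(t)\,y,\;f_2(t)\,z,\;f_1(t)\bigr),$$ where $\mathbb{S}^1=\mathbb{R}/T\mathbb{Z}$, is a minimal immersion. Let $J$ be its stability operator. Then for every $i\in\{1,\dots,k+1\}$ and $j\in\{1,\dots,\ell+1\}$, the function $$\zeta_{ij}(y,z,t)=\omega(t)\,y_i\,z_j,\qquad \omega(t)=f(t)^{-k}f_2(t)^{-\ell},$$ satisfies $$J(\zeta_{ij})=-n\,\zeta_{ij}.$$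
   Context: $\mathbb{S}^m$ is the unit sphere in $\mathbb{R}^{m+1}$ with its round metric; $y=(y_1,\dots,y_{k+1})\in\mathbb{S}^k$ and $z=(z_1,\dots,z_{\ell+1})\in\mathbb{S}^\ell$. An immersed hypersurface of $\mathbb{S}^{n+1}$ is minimal if its mean curvature vanishes identically. The stability operator of a minimal immersed hypersurface $M^n$ of $\mathbb{S}^{n+1}$ acts on smooth functions $u$ on $M$ by $J(u)=-\Delta u-nu-|A|^2u$, where $\Delta$ is the Laplace–Beltrami operator of the metric induced on $M$ by the immersion (the trace of the Hessian, so that $-\Delta$ is nonnegative), and $|A|^2=\kappa_1^2+\dots+\kappa_n^2$, with $\kappa_1,\dots,\kappa_n$ the principal curvatures of $M$ in $\mathbb{S}^{n+1}$. *)

(* Defs.v *)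
From HB Require Import structures.
From mathcomp Require Import all_boot all_order all_algebra.
From mathcomp Require Import all_classical all_reals all_analysis.
Import Order.TTheory GRing.Theory Num.Theory.
Import numFieldNormedType.Exports.

Set Implicit Arguments.
Unset Strict Implicit.
Unset Printing Implicit Defensive.

Local Open Scope classical_set_scope.
Local Open Scope ring_scope.

Definition dot (R : realType) (N : nat) (u v : 'rV[R]_N) : R :=
  \sum_(c < N) u 0 c * v 0 c.

(* The unit sphere of R^N, of dimension N - 1. *)
Definition unit_sphere (R : realType) (N : nat) : set 'rV[R]_N :=
  [set u | dot u u = 1].

Definition smooth (R : realType) (f : R -> R) : Prop :=
  forall (m : nat) (t : R), derivable (derive1n m f) t 1.

Definition partial (R : realType) (n : nat) (V : normedModType R) (a : 'I_n)
    (f : 'rV[R]_n -> V) : 'rV[R]_n -> V :=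
  fun x => 'D_(delta_mx 0 a) f x.

(* C^infinity on the open set U: all iterated partial derivatives exist and are
   differentiable at every point of U. *)
Definition smooth_on (R : realType) (n : nat) (V : normedModType R)
    (U : set 'rV[R]_n) (f : 'rV[R]_n -> V) : Prop :=
  forall (s : seq 'I_n) (x : 'rV[R]_n), U x ->
    differentiable (foldr (fun a g => partial a g) f s) x.

(* Smooth local parametrizations of an n-dimensional embedded submanifold M of
   the normed space E.  They need not be injective, only immersive: since
   dim M = n, they are local diffeomorphisms onto open pieces of M. *)
Definition local_param (R : realType) (n : nat) (E : normedModType R)
    (M : set E) (U : set 'rV[R]_n) (p : 'rV[R]_n -> E) : Prop :=
  [/\ open U, smooth_on U p, (forall x, U x -> M (p x)) &
      forall x, U x -> injective ('d p x)].

Section HypersurfaceOfSphere.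
Variables (R : realType) (n N : nat).

(* X is an immersion of an open subset of R^n into the unit sphere of R^N, where
   N = n + 2, so that X is a hypersurface of that sphere. *)
Variable X : 'rV[R]_n -> 'rV[R]_N.

Definition metric (x : 'rV[R]_n) : 'M[R]_n :=
  \matrix_(a, b) dot (partial a X x) (partial b X x).

(* christoffel c a b x is Gamma^c_(a b), for the Levi-Civita connection of the
   induced metric. *)
Definition christoffel (c a b : 'I_n) (x : 'rV[R]_n) : R :=
  2^-1 * \sum_(d < n) invmx (metric x) c d *
    (partial a (fun w => metric w d b) x + partial b (fun w => metric w d a) x
     - partial d (fun w => metric w a b) x).

Definition hessian (u : 'rV[R]_n -> R) (x : 'rV[R]_n) : 'M[R]_n :=
  \matrix_(a, b) (partial a (partial b u) x
                  - \sum_(c < n) christoffel c a b x * partial c u x).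

Definition laplacian (u : 'rV[R]_n -> R) (x : 'rV[R]_n) : R :=
  \tr (invmx (metric x) *m hessian u x).

Definition is_unit_normal (x : 'rV[R]_n) (nu : 'rV[R]_N) : Prop :=
  [/\ dot nu nu = 1, dot nu (X x) = 0 & forall a, dot nu (partial a X x) = 0].

(* One of the two opposite unit normals at x within the sphere.  The choice
   changes the sign of the second fundamental form, which affects neither the
   vanishing of the mean curvature nor |A|^2. *)
Definition unit_normal (x : 'rV[R]_n) : 'rV[R]_N := get (is_unit_normal x).

(* As the normal is orthogonal to X x, this is the second fundamental form in
   the sphere: the sphere part of the second derivative plays no role. *)
Definition second_form (x : 'rV[R]_n) : 'M[R]_n :=
  \matrix_(a, b) dot (partial a (partial b X) x) (unit_normal x).

Definition shape_operator (x : 'rV[R]_n) : 'M[R]_n :=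
  invmx (metric x) *m second_form x.

Definition mean_curvature (x : 'rV[R]_n) : R := \tr (shape_operator x).

(* kappa lists the eigenvalues of the shape operator with multiplicity; any
   other listing is a permutation of it. *)
Definition is_principal_curvatures (x : 'rV[R]_n) (kappa : 'rV[R]_n) : Prop :=
  char_poly (shape_operator x) = \prod_(a < n) ('X - (kappa 0 a)%:P).

Definition principal_curvatures (x : 'rV[R]_n) : 'rV[R]_n :=
  get (is_principal_curvatures x).

Definition norm2_A (x : 'rV[R]_n) : R :=
  \sum_(a < n) principal_curvatures x 0 a ^+ 2.

Definition stability_operator (u : 'rV[R]_n -> R) (x : 'rV[R]_n) : R :=
  - laplacian u x - n%:R * u x - norm2_A x * u x.

End HypersurfaceOfSphere.

Definition minimal_immersion (R : realType) (n N : nat) (E : normedModType R)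
    (M : set E) (Phi : E -> 'rV[R]_N) : Prop :=
  forall (U : set 'rV[R]_n) (p : 'rV[R]_n -> E), local_param M U p ->
    smooth_on U (Phi \o p) /\
    forall x, U x ->
      [/\ @unit_sphere R N (Phi (p x)),
          injective ('d (Phi \o p) x) &
          mean_curvature (Phi \o p) x = 0].

(* Points (y, z, t) of S^k x S^l x R.  The factor S^1 = R/TZ is represented by
   its universal cover R: functions on R/TZ are T-periodic functions of t, and
   local parametrizations of S^k x S^l x R/TZ lift locally to this cover. *)
Definition sphere_product (R : realType) (k l : nat) :
    set ('rV[R]_k.+1 * 'rV[R]_l.+1 * R)%type :=
  [set m | unit_sphere m.1.1 /\ unit_sphere m.1.2].

Section Rotational.
Variables (R : realType) (k l : nat) (f1 f2 : R -> R).

Definition prof (t : R) : R := Num.sqrt (1 - f1 t ^+ 2 - f2 t ^+ 2).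

Definition rot_map (m : 'rV[R]_k.+1 * 'rV[R]_l.+1 * R) :
    'rV[R]_(k.+1 + l.+1 + 1) :=
  let: (y, z, t) := m in
  row_mx (row_mx (prof t *: y) (f2 t *: z)) (f1 t)%:M.

Definition omega (t : R) : R := prof t ^- k * f2 t ^- l.

Definition zeta (i : 'I_k.+1) (j : 'I_l.+1)
    (m : 'rV[R]_k.+1 * 'rV[R]_l.+1 * R) : R :=
  let: (y, z, t) := m in omega t * y 0 i * z 0 j.

End Rotational.

(* Main.v *)
Require Import Defs.
From HB Require Import structures.
From mathcomp Require Import all_boot all_order all_algebra.
From mathcomp Require Import all_classical all_reals all_analysis.
From mathcomp Require Import ring lra zify.
Import Order.TTheory GRing.Theory Num.Theory.
Import numFieldNormedType.Exports.
Set Implicit Arguments.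
Unset Strict Implicit.
Local Open Scope classical_set_scope.
Local Open Scope ring_scope.

(** The function [zeta] is the restriction to the hypersurface of a function of
    the ambient space.  Write points of the ambient space as (Y, Z, s).  On the
    hypersurface Y = f y and Z = f2 z, so that [zeta] is the restriction of

      F (Y, Z, s) = |Y|^(-k-1) Y_i |Z|^(-l-1) Z_j.

    Each of the two factors is the Kelvin transform of a linear function, hence
    harmonic; so F is harmonic, and it is homogeneous of degree -(n - 1).  On a
    minimal hypersurface of the unit sphere, with position X and normal nu, the
    mean curvature vector in the ambient space is - n X, and therefore

      Delta u = Delta F - F_nu_nu - F_X_X - n F_X = - F_nu_nu,

    because F_X = - (n - 1) F and F_X_X = n (n - 1) F cancel.  The normal of a
    rotational hypersurface has the form nu = (A y, B z, c), so the derivatives of F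
    along nu only involve |Y| and |Z|; the principal curvatures are k1 = - A / f (k times), k2 = - B / f2
    (l times) and k3, the geodesic curvature of the profile curve, whence

      F_nu_nu = ((k k1 + l k2)^2 + k k1^2 + l k2^2) F.

    Minimality says k3 = - (k k1 + l k2), so the bracket is |A|^2, and
    - Delta u - n u - |A|^2 u = - n u.

    The statement is about an arbitrary parametrization, where neither the metric
    nor the Christoffel symbols are explicit.  Lemma [laplacian_along] computes
    the Laplacian of u from any field G with u_a = G . X_a, here the gradient of
    F along X; what is left is the trace of G_a . X_b against the inverse metric.
    The metric is a sum of three Gram matrices, one for each factor of the
    product, and [prod_frame_dual] and its consequences evaluate every trace
    needed, as well as the characteristic polynomial of the shape operator,
    without choosing coordinates.  Lemma [rotational_identity] collects the
    resulting scalars. *)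

(** * Linear algebra of a product metric *)

Lemma mulmx1C_eqdim (F : comUnitRingType) m n (e : m = n)
    (A : 'M[F]_(m, n)) (B : 'M[F]_(n, m)) : A *m B = 1%:M -> B *m A = 1%:M.
Proof. by subst m; exact: mulmx1C. Qed.

Lemma det_congruence (F : comNzRingType) m n (e : m = n)
    (A : 'M[F]_(m, n)) (D : 'M[F]_n) :
  \det (A *m D *m A^T) = \det (A *m A^T) * \det D.
Proof. by subst m; rewrite !det_mulmx det_tr; ring. Qed.

Lemma col_row0 (F : nmodType) m1 m2 m3 m4 (P : 'M[F]_(m1, m2)) (Q : 'M[F]_(m1, m3)) :
  col_mx (row_mx P Q) (0 : 'M[F]_(m4, _)) = row_mx (col_mx P 0) (col_mx Q 0).
Proof. by rewrite -row_mx0 -block_mxEv block_mxEh. Qed.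

Lemma row_col0 (F : nmodType) m1 m2 m3 m4 (P : 'M[F]_(m1, m2)) (Q : 'M[F]_(m3, m2)) :
  row_mx (col_mx P Q) (0 : 'M[F]_(_, m4)) = col_mx (row_mx P 0) (row_mx Q 0).
Proof. by rewrite -col_mx0 -block_mxEh block_mxEv. Qed.

(** With V, W, t the derivatives of the two sphere factors and of the parameter
    of the profile, the rows of (V W t) span the tangent space of the product of
    spheres; the two further rows y and z complete them to a square matrix, up to
    an equality of dimensions. *)
Definition prod_frame {F : nzRingType} {n p r} (V : 'M[F]_(n, p)) (W : 'M[F]_(n, r))
    (t : 'cV[F]_n) (y : 'rV[F]_p) (z : 'rV[F]_r) : 'M[F]_(n + 1 + 1, p + r + 1) :=
  col_mx (col_mx (row_mx (row_mx V W) t) (row_mx (row_mx y 0) 0))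
         (row_mx (row_mx 0 z) 0).

Definition diag3 {F : nzRingType} {n p r} (A : 'M[F]_n) (B : 'M[F]_p) (C : 'M[F]_r) :
   'M[F]_(n + p + r) := block_mx (block_mx A 0 0 B) 0 0 C.

Lemma det_diag3 (F : comNzRingType) n p r (A : 'M[F]_n) (B : 'M[F]_p) (C : 'M[F]_r) :
  \det (diag3 A B C) = \det A * \det B * \det C.
Proof. by rewrite /diag3 !det_ublock. Qed.

(** The completed frame diagonalizes the metric by blocks: y is orthogonal to the
    rows of V and z to those of W. *)
Lemma prod_frameE (F : comNzRingType) n p r (V : 'M[F]_(n, p)) (W : 'M[F]_(n, r))
    (t : 'cV[F]_n) (y : 'rV[F]_p) (z : 'rV[F]_r) (a b q : F) :
  V *m y^T = 0 -> W *m z^T = 0 -> y *m y^T = 1%:M -> z *m z^T = 1%:M ->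
  prod_frame V W t y z *m diag3 a%:M b%:M q%:M *m (prod_frame V W t y z)^T =
  diag3 (a *: (V *m V^T) + b *: (W *m W^T) + q *: (t *m t^T)) a%:M b%:M.
Proof.
move=> Vy Wz yy zz.
have yV : y *m V^T = 0 by rewrite -[LHS]trmxK trmx_mul trmxK Vy trmx0.
have zW : z *m W^T = 0 by rewrite -[LHS]trmxK trmx_mul trmxK Wz trmx0.
rewrite /prod_frame /diag3 !tr_col_mx !tr_row_mx !trmx0.
rewrite !(mul_col_mx, mul_row_block, mul_mx_row, mul_row_col, mulmx0, mul0mx, add0r, addr0).
have sA m1 m2 m3 c (A : 'M[F]_(m1, m2)) (B : 'M[F]_(m2, m3)) : c *: A *m B = c *: (A *m B).
  by rewrite scalemxAl.
rewrite !mul_mx_scalar !sA Vy Wz yV zW yy zz !scaler0 !scalemx1.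
by rewrite !block_mxEh col_row0 col_mx0.
Qed.

Section ProductFrame.
Variables (F : fieldType) (n p r : nat).
Variables (V : 'M[F]_(n, p.+1)) (W : 'M[F]_(n, r.+1)) (t : 'cV[F]_n).
Variables (y : 'rV[F]_p.+1) (z : 'rV[F]_r.+1) (a b q : F) (g : 'M[F]_n).
Hypothesis dim : (n + 1 + 1 = p.+1 + r.+1 + 1)%N.
Hypotheses (a0 : a != 0) (b0 : b != 0).
Hypotheses (Vy : V *m y^T = 0) (Wz : W *m z^T = 0).
Hypotheses (yy : y *m y^T = 1%:M) (zz : z *m z^T = 1%:M).
Hypothesis gE : g = a *: (V *m V^T) + b *: (W *m W^T) + q *: (t *m t^T).
Hypothesis gU : g \in unitmx.

(** The completed frame M satisfies M D M^T = diag (g, a, b); inverting and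
    moving M to the other side gives D M^T diag (g^-1, 1/a, 1/b) M = 1, whose
    blocks are these identities. *)
Lemma prod_frame_dual :
  [/\ a *: (V^T *m invmx g *m V) = 1%:M - y^T *m y,
      b *: (W^T *m invmx g *m W) = 1%:M - z^T *m z,
      q *: (t^T *m invmx g *m t) = 1%:M &
      [/\ V^T *m invmx g *m W = 0, V^T *m invmx g *m t = 0 &
          W^T *m invmx g *m t = 0]].
Proof.
have := prod_frameE t a b q Vy Wz yy zz; rewrite -gE.
set M := prod_frame _ _ _ _ _ => ME.
have : M *m (diag3 a%:M b%:M q%:M *m M^T *m diag3 (invmx g) a^-1%:M b^-1%:M) = 1%:M.
  rewrite !mulmxA ME /diag3 !(mulmx_block, mulmx0, mul0mx, add0r, addr0).
  by rewrite mulmxV // -!scalar_mxM !divff // -!scalar_mx_block.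
move/(mulmx1C_eqdim dim).
rewrite /M /prod_frame /diag3 !tr_col_mx !tr_row_mx !trmx0.
rewrite !(mul_col_mx, mul_block_col, mul_mx_row, mul_row_col, mul_row_block, mulmx0, mul0mx, add0r, addr0).
rewrite !(row_mx0, col_mx0, add_row_mx, add0r, addr0).
rewrite !(mul_row_col, mul_col_mx, mul_mx_row, mulmx0, mul0mx, add0r, addr0).
rewrite !(add_col_mx, add_row_mx, add0r, addr0, row_mx0).
rewrite !scalar_mx_block !block_mxEv row_col0.
(* The zero block has to be split in two for the blocks to be compared. *)
have zr m m1 m2 : (0 : 'M[F]_(m, m1 + m2)) = row_mx 0 0 by rewrite row_mx0.
rewrite [X in col_mx _ (row_mx X 1%:M)]zr.
have sA m1 m2 m3 c (A : 'M[F]_(m1, m2)) (B : 'M[F]_(m2, m3)) : c *: A *m B = c *: (A *m B).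
  by rewrite scalemxAl.
rewrite !mul_scalar_mx !mul_mx_scalar !scalerA !mulVf // !scale1r !sA.
move=> /eq_col_mx[/eq_col_mx[/eq_row_mx[/eq_row_mx[VV VW] Vt]]].
move=> /eq_row_mx[/eq_row_mx[_ WW] Wt] /eq_row_mx[_ tt].
have inj c m1 m2 (c0 : c != 0) (A : 'M[F]_(m1, m2)) : c *: A = 0 -> A = 0.
  by move/eqP; rewrite scaler_eq0 (negbTE c0) => /eqP.
split=> //; last by split; [exact: (inj _ _ _ a0 _ VW)|exact: (inj _ _ _ a0 _ Vt)|exact: (inj _ _ _ b0 _ Wt)].
- by rewrite -VV addrK.
- by rewrite -WW addrK.
Qed.

(** The matrix X g - h has the same shape as g, with a, b, q multiplied by
    X - k1, X - k2, X - k3.  Comparing the determinants of the two congruences of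
    [prod_frameE] gives the characteristic polynomial; the rows y and z account
    for one factor X - k1 and one factor X - k2 too many. *)
Lemma char_poly_prod_frame (k1 k2 k3 : F) (h : 'M[F]_n) :
  h = (k1 * a) *: (V *m V^T) + (k2 * b) *: (W *m W^T) + (k3 * q) *: (t *m t^T) ->
  char_poly (invmx g *m h) = ('X - k1%:P) ^+ p * ('X - k2%:P) ^+ r * ('X - k3%:P).
Proof.
move=> hE.
pose c := @polyC F.
pose Mc := prod_frame (map_mx c V) (map_mx c W) (map_mx c t) (map_mx c y) (map_mx c z).
have Vyc : map_mx c V *m (map_mx c y)^T = 0 by rewrite map_trmx -map_mxM Vy map_mx0.
have Wzc : map_mx c W *m (map_mx c z)^T = 0 by rewrite map_trmx -map_mxM Wz map_mx0.
have yyc : map_mx c y *m (map_mx c y)^T = 1%:M by rewrite map_trmx -map_mxM yy map_mx1.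
have zzc : map_mx c z *m (map_mx c z)^T = 1%:M by rewrite map_trmx -map_mxM zz map_mx1.
have E A B C := prod_frameE (map_mx c t) A B C Vyc Wzc yyc zzc.
(* The first factor does not depend on A, B, C: it will be eliminated between
   two instances. *)
have detE A B C : \det (Mc *m Mc^T) * (A ^+ p.+1 * B ^+ r.+1 * C) =
    \det (A *: map_mx c (V *m V^T) + B *: map_mx c (W *m W^T) + C *: map_mx c (t *m t^T)) * A * B.
  move: (E A B C) => /(congr1 determinant).
  by rewrite (det_congruence dim) !det_diag3 !det_scalar !map_trmx -!map_mxM !expr1.
have gc : map_mx c g = c a *: map_mx c (V *m V^T) + c b *: map_mx c (W *m W^T) + c q *: map_mx c (t *m t^T).
  by rewrite gE !map_mxD !map_mxZ.
have hc : 'X *: map_mx c g - map_mx c h = (('X - c k1) * c a) *: map_mx c (V *m V^T)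
    + (('X - c k2) * c b) *: map_mx c (W *m W^T) + (('X - c k3) * c q) *: map_mx c (t *m t^T).
  rewrite gc hE !map_mxD !map_mxZ !rmorphM /= !mulrBl !scalerBl !scalerDr !scalerA.
  by apply/matrixP => i1 i2; rewrite !mxE; ring.
have cpE : map_mx c g *m char_poly_mx (invmx g *m h) = 'X *: map_mx c g - map_mx c h.
  rewrite /char_poly_mx mulmxBr mul_mx_scalar -map_mxM mulmxA mulmxV // mul1mx //.
have cX k : 'X - c k != 0 by rewrite polyXsubC_eq0.
have ca0 : c a != 0 by rewrite polyC_eq0.
have cb0 : c b != 0 by rewrite polyC_eq0.
have g0 : \det (map_mx c g) != 0.
  by rewrite det_map_mx polyC_eq0 -unitfE -unitmxE.
have D1 := detE (c a) (c b) (c q); rewrite -gc in D1.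
have D2 := detE (('X - c k1) * c a) (('X - c k2) * c b) (('X - c k3) * c q).
rewrite -hc -cpE det_mulmx -/(char_poly _) in D2.
set cp := char_poly _ in D2 *.
have K0 : \det (map_mx c g) * c a * c b * ('X - c k1) * ('X - c k2) != 0.
  by rewrite !mulf_neq0.
apply: (mulfI K0).
transitivity (\det (map_mx c g) * cp * (('X - c k1) * c a) * (('X - c k2) * c b)); first by ring.
rewrite -D2 !exprMn !exprS.
rewrite !exprS in D1.
transitivity (\det (map_mx c g) * c a * c b * (('X - c k1) * ('X - c k1) ^+ p
   * (('X - c k2) * ('X - c k2) ^+ r) * ('X - c k3))); last by rewrite /c; ring.
rewrite -D1; ring.
Qed.

Lemma prod_metric_tr : g^T = g.
Proof. by rewrite gE !raddfD /= !linearZ /= !trmx_mul !trmxK. Qed.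

(** A vector orthogonal to the tangent space of the product has components along
    y and z only: multiply the relation by V^T g^-1, W^T g^-1 and t^T g^-1. *)
Lemma prod_frame_kernel (c d m : F) (v : 'rV[F]_p.+1) (u : 'rV[F]_r.+1) :
  c != 0 -> d != 0 ->
  c *: (V *m v^T) + d *: (W *m u^T) + m *: t = 0 ->
  [/\ v = (v *m y^T) *m y, u = (u *m z^T) *m z & m = 0].
Proof.
move=> c0 d0 E; have [VV WW tt [VW Vt Wt]] := prod_frame_dual.
have gT := prod_metric_tr.
have WV : W^T *m invmx g *m V = 0.
  by apply: trmx_inj; rewrite !trmx_mul trmxK trmx_inv gT mulmxA VW trmx0.
have tV : t^T *m invmx g *m V = 0.
  by apply: trmx_inj; rewrite !trmx_mul trmxK trmx_inv gT mulmxA Vt trmx0.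
have tW : t^T *m invmx g *m W = 0.
  by apply: trmx_inj; rewrite !trmx_mul trmxK trmx_inv gT mulmxA Wt trmx0.
have proj s (A : 'M[F]_(s, n)) : c *: (A *m V *m v^T) + d *: (A *m W *m u^T) + m *: (A *m t) = 0.
  by rewrite -(mulmx0 _ A) -E !mulmxDr -!scalemxAr !mulmxA.
have cancel0 e s1 s2 (M : 'M[F]_(s1, s2)) : e != 0 -> e *: M = 0 -> M = 0.
  by move=> e0 /eqP; rewrite scaler_eq0 (negbTE e0) => /eqP.
split.
- have := proj _ (V^T *m invmx g); rewrite VW Vt mul0mx !scaler0 !addr0.
  move/(cancel0 _ _ _ _ c0)/(congr1 (fun M => a *: M)); rewrite scaler0 scalemxAl VV.
  move=> H; apply: trmx_inj; apply/eqP; rewrite -subr_eq0 -H mulmxBl mul1mx.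
  by rewrite !trmx_mul trmxK mulmxA.
- have := proj _ (W^T *m invmx g); rewrite WV Wt mul0mx !scaler0 add0r !addr0.
  move/(cancel0 _ _ _ _ d0)/(congr1 (fun M => b *: M)); rewrite scaler0 scalemxAl WW.
  move=> H; apply: trmx_inj; apply/eqP; rewrite -subr_eq0 -H mulmxBl mul1mx.
  by rewrite !trmx_mul trmxK mulmxA.
- have := proj _ (t^T *m invmx g); rewrite tV tW !mul0mx !scaler0 !add0r.
  move/(congr1 (fun M => q *: M)); rewrite scaler0 scalerA mulrC -scalerA tt.
  by move/(congr1 (fun M : 'M[F]_1 => M 0 0)); rewrite !mxE eqxx mulr1.
Qed.

Let T (M : 'M[F]_n) : F := \tr (invmx g *m M).

Lemma trace_invmx_tr M : \tr (invmx g *m M^T) = T M.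
Proof.
by rewrite -{1}prod_metric_tr -trmx_inv -trmx_mul mxtrace_tr mxtrace_mulC.
Qed.

Lemma trace_invmx_outer s (A B : 'M[F]_(n, s)) : T (A *m B^T) = \tr (B^T *m invmx g *m A).
Proof. by rewrite /T mulmxA mxtrace_mulC mulmxA. Qed.

(** The matrix a V^T g^-1 V is the projection orthogonal to y, of trace p. *)
Lemma trace_invmx_blocks :
  [/\ q != 0, T (V *m V^T) = p%:R / a, T (W *m W^T) = r%:R / b & T (t *m t^T) = q^-1].
Proof.
have [VV WW tt _] := prod_frame_dual.
have q0 : q != 0.
  apply/eqP => q0; have := congr1 (fun A : 'M[F]_1 => A 0 0) tt.
  by rewrite q0 scale0r !mxE eqxx => /eqP; rewrite eq_sym oner_eq0.
have tr1 m (v : 'rV[F]_m.+1) (c : F) (M : 'M[F]_m.+1) : c != 0 -> v *m v^T = 1%:M ->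
    c *: M = 1%:M - v^T *m v -> \tr M = m%:R / c.
  move=> c0 vv /(congr1 mxtrace); rewrite mxtraceZ raddfB /= mxtrace1 mxtrace_mulC vv.
  by rewrite mxtrace1 -natrB // subSS subn0 => <-; rewrite mulrAC divff // mul1r.
rewrite !trace_invmx_outer (tr1 _ y a) // (tr1 _ z b) //; split=> //.
apply: (mulfI q0); rewrite divff // -mxtraceZ tt mxtrace1 //.
Qed.

Lemma trace_invmx_mixed i j :
  [/\ T (col i V *m (col j W)^T) = 0, T (col j W *m (col i V)^T) = 0,
      T (col i V *m t^T) = 0, T (t *m (col i V)^T) = 0 &
      T (col j W *m t^T) = 0 /\ T (t *m (col j W)^T) = 0].
Proof.
have [_ _ _ [VW Vt Wt]] := prod_frame_dual.
have E1 : T (col j W *m (col i V)^T) = 0.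
  rewrite trace_invmx_outer !colE trmx_mul -!mulmxA [V^T *m _]mulmxA [_ *m (W *m _)]mulmxA VW.
  by rewrite mul0mx mulmx0 mxtrace0.
have E2 : T (t *m (col i V)^T) = 0.
  by rewrite trace_invmx_outer !colE trmx_mul -!mulmxA [V^T *m _]mulmxA Vt mulmx0 mxtrace0.
have E3 : T (t *m (col j W)^T) = 0.
  by rewrite trace_invmx_outer !colE trmx_mul -!mulmxA [W^T *m _]mulmxA Wt mulmx0 mxtrace0.
split=> //; last split=> //.
- by rewrite -trace_invmx_tr trmx_mul trmxK.
- by rewrite -trace_invmx_tr trmx_mul trmxK.
- by rewrite -trace_invmx_tr trmx_mul trmxK.
Qed.
End ProductFrame.

(** * Directional derivatives *)

Section Calculus.
Variables (R : realType) (V : normedModType R).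
Implicit Types (x v : V).

Lemma is_derive_mx m n (M : V -> 'M[R]_(m, n)) (dM : 'M[R]_(m, n)) x v :
  (forall i j, is_derive x v (fun w => M w i j) (dM i j)) -> is_derive x v M dM.
Proof.
move=> H; have dd : derivable M x v.
  by apply/derivable_mxP => i j; case: (H i j).
apply: DeriveDef => //; rewrite derive_mx //.
by apply/matrixP => i j; rewrite mxE; case: (H i j).
Qed.

Lemma is_derive_coord {m n} (M : V -> 'M[R]_(m, n)) dM x v i j :
  is_derive x v M dM -> is_derive x v (fun w => M w i j) (dM i j).
Proof.
move=> [dd <-]; apply: DeriveDef; first by move/derivable_mxP: dd.
by rewrite derive_mx // mxE.
Qed.

Lemma is_derive_dot {N} (F G : V -> 'rV[R]_N) dF dG x v :
  is_derive x v F dF -> is_derive x v G dG ->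
  is_derive x v (fun w => dot (F w) (G w)) (dot dF (G x) + dot (F x) dG).
Proof.
move=> hF hG.
have -> : (fun w => dot (F w) (G w)) =
    \sum_(c < N) ((fun w => F w 0 c) * (fun w => G w 0 c)).
  by rewrite funeqE => w; rewrite /dot fct_sumE.
apply: is_derive_eq.
  apply: is_derive_sum => c.
  by apply: is_deriveM; apply: is_derive_coord.
rewrite /dot -big_split /=; apply: eq_bigr => c _.
by rewrite addrC; congr (_ + _); rewrite mulrC.
Qed.

(** The inner function need only be derivable in the direction v, since everything
    happens on the line through x. *)
Lemma is_derive_compR (g : R -> R) (t : V -> R) dg dt x v :
  is_derive (t x) 1 g dg -> is_derive x v t dt ->
  is_derive x v (fun w => g (t w)) (dg * dt).
Proof.
move=> [dg1 <-] [dt1 <-].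
pose s := fun h : R => t (h *: v + x).
have s0 : s 0 = t x by rewrite /s scale0r add0r.
have ds : derivable s 0 1 by exact: (derivable1P t x v).1 dt1.
have Ds : 'D_1 s 0 = 'D_v t x.
  rewrite /derive; set g1 := fun h => h^-1 *: _; set g2 := fun h => h^-1 *: _.
  suff -> : g1 = g2 by []; rewrite /g1 /g2 funeqE => h /=.
  by rewrite /s addr0 scale0r add0r [_%:A]mulr1.
have dgt : derivable g (s 0) 1 by rewrite s0; exact: dg1.
have dgs : derivable (g \o s) 0 1.
  apply/derivable1_diffP; apply: differentiable_comp.
    exact: (derivable1_diffP _ _).1 ds.
  exact: (derivable1_diffP _ _).1 dgt.
apply: DeriveDef; first by apply: (derivable1P _ x v).2 dgs.
have -> : 'D_v (fun w => g (t w)) x = 'D_1 (g \o s) 0.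
  rewrite /derive; set g1 := fun h => h^-1 *: _; set g2 := fun h => h^-1 *: _.
  suff -> : g1 = g2 by []; rewrite /g1 /g2 funeqE => h /=.
  by rewrite /s addr0 scale0r add0r [_%:A]mulr1.
have := derive1_comp ds dgt; rewrite !derive1E s0 Ds; exact.
Qed.

Lemma is_derive_cst_on (U : set V) (f : V -> R) (c df : R) x v :
  open U -> U x -> (forall w, U w -> f w = c) -> is_derive x v f df -> df = 0.
Proof.
move=> oU Ux fc [_ <-]; rewrite -(derive_cst (c : R) x v).
by apply: near_eq_derive; near=> w; apply: fc; near: w; apply: open_nbhs_nbhs.
Unshelve. all: by end_near. Qed.

Lemma is_derive_scale m (a : V -> R) (F : V -> 'rV[R]_m) da dF x v :
  is_derive x v a da -> is_derive x v F dF ->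
  is_derive x v (fun w => a w *: F w) (a x *: dF + da *: F x).
Proof.
move=> ha hF; apply: is_derive_mx => i j.
have -> : (fun w => (a w *: F w) i j) = a * (fun w => F w i j).
  by rewrite funeqE => w; rewrite mxE.
apply: is_derive_eq; first by apply: is_deriveM; apply: is_derive_coord.
by rewrite !mxE /=; congr (_ + _); rewrite mulrC.
Qed.

Lemma is_derive_row_mx m1 m2 (F : V -> 'rV[R]_m1) (G : V -> 'rV[R]_m2) dF dG x v :
  is_derive x v F dF -> is_derive x v G dG ->
  is_derive x v (fun w => row_mx (F w) (G w)) (row_mx dF dG).
Proof.
move=> hF hG; apply: is_derive_mx => i j.
case: (split_ordP j) => c ->.
  rewrite row_mxEl (_ : (fun w => _) = (fun w => F w i c)); first exact: is_derive_coord.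
  by rewrite funeqE => w; rewrite row_mxEl.
rewrite row_mxEr (_ : (fun w => _) = (fun w => G w i c)); first exact: is_derive_coord.
by rewrite funeqE => w; rewrite row_mxEr.
Qed.

Lemma is_derive_scalar_mx (f : V -> R) df x v :
  is_derive x v f df -> is_derive x v (fun w => (f w)%:M : 'rV[R]_1) (df%:M).
Proof.
move=> hf; apply: is_derive_mx => i j; rewrite !(ord1 i) !(ord1 j) mxE eqxx mulr1n.
rewrite (_ : (fun w => _) = f) // funeqE => w; by rewrite mxE eqxx mulr1n.
Qed.

Lemma is_derive_mul (f g : V -> R) (df dg : R) x v :
  is_derive x v f df -> is_derive x v g dg ->
  is_derive x v (fun w => f w * g w) (df * g x + f x * dg).
Proof.
move=> hf hg; have H := @is_deriveM _ _ f g x v df dg hf hg. apply: is_derive_eq H _.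
by rewrite addrC /GRing.scale /=; congr (_ + _); rewrite mulrC.
Qed.

Lemma is_derive_powV (r : V -> R) (dr : R) k x v : r x != 0 ->
  is_derive x v r dr ->
  is_derive x v (fun w => r w ^- k) (- (k%:R * dr / r x * r x ^- k)).
Proof.
move=> r0 hr; elim: k => [|k IH].
  rewrite (_ : (fun w => _) = cst 1); last by rewrite funeqE => w; rewrite expr0 invr1.
  by rewrite !mul0r oppr0; apply: is_derive_cst.
have hV : is_derive x v (fun w => (r w)^-1) (- (r x) ^- 2 *: dr).
  case: hr => d1 <-; apply: DeriveDef; [exact: derivableV | exact: deriveV].
rewrite (_ : (fun w => _) = (fun w => r w ^- k * (r w)^-1)); last first.
  by rewrite funeqE => w; rewrite exprSr invfM mulrC.
apply: is_derive_eq (is_derive_mul IH hV) _.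
rewrite /GRing.scale /= (exprS _ k) -natr1.
have rk0 : r x ^+ k != 0 by rewrite expf_neq0.
by field; rewrite r0 rk0.
Qed.
End Calculus.

Lemma is_derive_pair (R : realType) (V W1 W2 : normedModType R)
    (F : V -> (W1 * W2)%type) dF (x v : V) :
  is_derive x v F dF ->
  is_derive x v (fun w => (F w).1) dF.1 /\ is_derive x v (fun w => (F w).2) dF.2.
Proof.
move=> [/cvg_ex [l cl] <-].
have -> : 'D_v F x = l by apply: cvg_lim.
split; (apply: DeriveDef; [apply/cvg_ex; eexists|apply: cvg_lim => //]).
- exact: (cvg_comp _ _ cl (@cvg_fst _ _ _ _ _)).
- exact: (cvg_comp _ _ cl (@cvg_fst _ _ _ _ _)).
- exact: (cvg_comp _ _ cl (@cvg_snd _ _ _ _ _)).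
- exact: (cvg_comp _ _ cl (@cvg_snd _ _ _ _ _)).
Qed.

(** * Symmetry of second derivatives *)

Section Schwarz.
Variables (R : realType) (V : normedModType R).

Lemma is_derive_line (f : V -> R) (u c : V) (s df : R) :
  is_derive (s *: u + c) u f df -> is_derive s 1 (fun r => f (r *: u + c)) df.
Proof.
have E : (fun h => h^-1 *: (((fun r => f (r *: u + c)) \o shift s) (h *: (1 : R)) - f (s *: u + c)))
   = (fun h => h^-1 *: ((f \o shift (s *: u + c)) (h *: u) - f (s *: u + c))).
  by rewrite funeqE => h /=; rewrite [h%:A]mulr1 scalerDl addrA.
by move=> [d1 <-]; apply: DeriveDef; rewrite /derivable /derive E.
Qed.

(** Two applications of the mean value theorem, first in the direction u to
    f (. + h v) - f, then in the direction v. *)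
Lemma second_difference (f fu fvu : V -> R) (u v x : V) (h : R) : 0 < h ->
  (forall s r, 0 <= s <= h -> 0 <= r <= h ->
     is_derive (s *: u + (r *: v + x)) u f (fu (s *: u + (r *: v + x))) /\
     is_derive (s *: u + (r *: v + x)) v fu (fvu (s *: u + (r *: v + x)))) ->
  exists s r, [/\ 0 <= s <= h, 0 <= r <= h &
    f (h *: u + (h *: v + x)) - f (h *: u + x) - (f (h *: v + x) - f x) =
    fvu (s *: u + (r *: v + x)) * h ^+ 2].
Proof.
move=> h0 H.
have hh : 0 <= h <= h by rewrite lexx ltW.
have h00 : (0 : R) <= 0 <= h by rewrite lexx ltW.
pose phi (s : R) : R := f (s *: u + (h *: v + x)) - f (s *: u + x).
have dphi s : 0 <= s <= h ->
    is_derive s 1 phi (fu (s *: u + (h *: v + x)) - fu (s *: u + x)).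
  move=> hs; apply: is_deriveB; apply: is_derive_line; first exact: (H _ _ hs hh).1.
  by have := (H _ _ hs h00).1; rewrite scale0r add0r.
have cphi : {within `[0, h], continuous phi}.
  by apply: derivable_within_continuous => s; rewrite in_itv /= => /dphi [].
have oI (s : R) : s \in `]0, h[%R -> 0 <= s <= h.
  by rewrite in_itv /= => /andP[s1 s2]; rewrite !ltW.
have [s /oI hs Es] := MVT h0 (fun s sI => dphi s (oI s sI)) cphi.
pose psi (r : R) : R := fu (r *: v + (s *: u + x)).
have dpsi r : 0 <= r <= h -> is_derive r 1 psi (fvu (s *: u + (r *: v + x))).
  move=> hr; apply: is_derive_line.
  by have := (H _ _ hs hr).2; rewrite addrCA.
have cpsi : {within `[0, h], continuous psi}.
  by apply: derivable_within_continuous => r; rewrite in_itv /= => /dpsi [].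
have [r /oI hr Er] := MVT h0 (fun r rI => dpsi r (oI r rI)) cpsi.
exists s, r; split=> //.
move: Es Er; rewrite /phi /psi !scale0r !add0r !subr0 => Es Er.
transitivity ((fu (s *: u + (h *: v + x)) - fu (s *: u + x)) * h).
  by rewrite -Es; ring.
by rewrite [s *: u + (_ + _)]addrCA Er; ring.
Qed.

(** The second difference is symmetric in u and v, so in every neighbourhood of x
    the functions fvu and fuv take a common value. *)
Lemma schwarz (U : set V) (f fu fv fvu fuv : V -> R) (u v x : V) :
  open U -> U x ->
  (forall w, U w -> is_derive w u f (fu w)) ->
  (forall w, U w -> is_derive w v f (fv w)) ->
  (forall w, U w -> is_derive w v fu (fvu w)) ->
  (forall w, U w -> is_derive w u fv (fuv w)) ->
  {for x, continuous fvu} -> {for x, continuous fuv} -> fvu x = fuv x.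
Proof.
move=> oU Ux Hu Hv Hvu Huv cvu cuv.
apply/eqP; rewrite -subr_eq0 -normr_le0; apply/ler_addgt0Pl => e e0; rewrite addr0.
have e20 : 0 < e / 2 by rewrite divr_gt0.
have : \forall w \near x, [/\ U w, `|fvu x - fvu w| < e / 2 & `|fuv x - fuv w| < e / 2].
  near=> w; split.
  - by near: w; apply: open_nbhs_nbhs.
  - by near: w; move/cvgrPdist_lt: cvu; apply.
  - by near: w; move/cvgrPdist_lt: cuv; apply.
move=> /nbhs_ballP[d /= d0 B].
(* This step size keeps s u + r v shorter than d for s and r at most h; the
   summand 1 avoids a division by zero. *)
pose m := `|u| + `|v| + 1.
have m0 : 0 < m by rewrite /m ltr_wpDl // addr_ge0.
pose h := d / m.
have h0 : 0 < h by rewrite divr_gt0.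
have inB s r : 0 <= s <= h -> 0 <= r <= h -> ball x d (s *: u + (r *: v + x)).
  move=> /andP[s0 sh] /andP[r0 rh]; rewrite -ball_normE /ball_ /=.
  rewrite addrA opprD addrCA subrr addr0 normrN.
  apply: le_lt_trans (ler_normD _ _) _; rewrite !normrZ !ger0_norm //.
  apply: (@le_lt_trans _ _ (h * (`|u| + `|v|))).
    by rewrite mulrDr lerD // ler_wpM2r.
  by rewrite /h mulrAC ltr_pdivrMr // ltr_pM2l // /m ltrDl.
have [s [r [hs hr E1]]] := @second_difference f fu fvu u v x h h0 (fun s r hs hr =>
  let: And3 Uw _ _ := B _ (inB s r hs hr) in conj (Hu _ Uw) (Hvu _ Uw)).
have inB' s' r' : 0 <= s' <= h -> 0 <= r' <= h -> ball x d (s' *: v + (r' *: u + x)).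
  by move=> h1 h2; rewrite addrCA; apply: inB.
have [s' [r' [hs' hr' E2]]] := @second_difference f fv fuv v u x h h0 (fun s r hs hr =>
  let: And3 Uw _ _ := B _ (inB' s r hs hr) in conj (Hv _ Uw) (Huv _ Uw)).
have h20 : h ^+ 2 != 0 by rewrite expf_neq0 // gt_eqF.
have E : fvu (s *: u + (r *: v + x)) = fuv (s' *: v + (r' *: u + x)).
  apply: (mulIf h20); rewrite -E1 -E2 [h *: v + (_ + _)]addrCA; ring.
have [_ A1 _] := B _ (inB _ _ hs hr); have [_ _ A2] := B _ (inB' _ _ hs' hr').
rewrite -E distrC in A2.
rewrite (splitr e); apply: le_trans (lerD (ltW A1) (ltW A2)).
apply: le_trans (ler_normD _ _); rewrite addrA subrK //.
Unshelve. all: by end_near. Qed.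
End Schwarz.

(** * The Euclidean inner product *)

Section Dot.
Variables (R : realType) (N : nat).
Implicit Types u v w : 'rV[R]_N.

Lemma dotE u v : dot u v = (u *m v^T) 0 0.
Proof. by rewrite mxE; apply: eq_bigr => c _; rewrite mxE. Qed.

Lemma mul_row_tr u v : u *m v^T = (dot u v)%:M.
Proof. by rewrite [LHS]mx11_scalar dotE. Qed.

Lemma dotC u v : dot u v = dot v u.
Proof. by apply: eq_bigr => c _; rewrite mulrC. Qed.

Lemma dotDl u v w : dot (u + v) w = dot u w + dot v w.
Proof. by rewrite !dotE mulmxDl mxE. Qed.

Lemma dotDr u v w : dot w (u + v) = dot w u + dot w v.
Proof. by rewrite ![dot w _]dotC dotDl. Qed.

Lemma dotZl a u w : dot (a *: u) w = a * dot u w.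
Proof. by rewrite !dotE -scalemxAl mxE. Qed.

Lemma dotZr a u w : dot w (a *: u) = a * dot w u.
Proof. by rewrite ![dot w _]dotC dotZl. Qed.

Lemma dotNl u w : dot (- u) w = - dot u w.
Proof. by rewrite -scaleN1r dotZl mulN1r. Qed.

Lemma dot_ge0 u : 0 <= dot u u.
Proof. by apply: sumr_ge0 => c _; rewrite -expr2 sqr_ge0. Qed.

Lemma dot_eq0 u : dot u u = 0 -> u = 0.
Proof.
move=> /eqP; rewrite psumr_eq0; last by move=> c _; rewrite -expr2 sqr_ge0.
move=> /allP H; apply/rowP => c; rewrite mxE.
by have := H c (mem_index_enum _); rewrite /= -expr2 sqrf_eq0 => /eqP.
Qed.

Lemma dot_delta u j : dot (delta_mx 0 j) u = u 0 j.
Proof.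
rewrite /dot (bigD1 j) //= big1 ?addr0 => [|c /negbTE cj]; rewrite mxE eqxx ?eqxx ?mul1r //=.
by rewrite cj mul0r.
Qed.

Lemma mul_rows_tr n (F : 'I_n -> 'rV[R]_N) v :
  (\matrix_a F a) *m v^T = \col_a dot (F a) v.
Proof.
by apply/matrixP => a j; rewrite (ord1 j) !mxE; apply: eq_bigr => c _; rewrite !mxE.
Qed.

Lemma mul_tr_rows n (F : 'I_n -> 'rV[R]_N) v :
  v *m (\matrix_a F a)^T = \row_a dot v (F a).
Proof.
by apply/matrixP => i a; rewrite (ord1 i) !mxE; apply: eq_bigr => c _; rewrite !mxE.
Qed.

Lemma gram_rows n (F : 'I_n -> 'rV[R]_N) :
  (\matrix_a F a) *m (\matrix_a F a)^T = \matrix_(a, b) dot (F a) (F b).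
Proof. by apply/matrixP => a b; rewrite !mxE; apply: eq_bigr => c _; rewrite !mxE. Qed.
End Dot.

Lemma dot_row_mx (R : realType) m n (a c : 'rV[R]_m) (b d : 'rV[R]_n) :
  dot (row_mx a b) (row_mx c d) = dot a c + dot b d.
Proof. by rewrite !dotE tr_row_mx mul_row_col mxE. Qed.

Lemma dot_scalar_mx (R : realType) (a b : R) : dot (a%:M : 'rV[R]_1) b%:M = a * b.
Proof. by rewrite /dot big_ord1 !mxE !eqxx !mulr1n. Qed.

(** * Hypersurfaces of the unit sphere *)

Section Smooth.
Variables (R : realType) (n : nat) (V : normedModType R).
Variables (U : set 'rV[R]_n) (f : 'rV[R]_n -> V).
Hypothesis fs : smooth_on U f.

Lemma smooth_on_partial a : smooth_on U (partial a f).
Proof. by move=> s w Uw; have := fs (rcons s a) Uw; rewrite foldr_rcons. Qed.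

Lemma smooth_on_diff w : U w -> differentiable f w.
Proof. exact: (fs [::]). Qed.

Lemma smooth_on_is_derive a w : U w -> is_derive w (delta_mx 0 a) f (partial a f w).
Proof. by move=> Uw; apply/derivableP/diff_derivable/smooth_on_diff. Qed.
End Smooth.

Section Hypersurface.
Variables (R : realType) (n N : nat) (dim : (n + 1 + 1 = N)%N).
Variables (X : 'rV[R]_n -> 'rV[R]_N) (U : set 'rV[R]_n).
Hypotheses (oU : open U) (Xs : smooth_on U X).
Hypothesis Xsph : forall w, U w -> dot (X w) (X w) = 1.

Definition tangents (w : 'rV[R]_n) : 'M[R]_(n, N) := \matrix_a partial a X w.

Lemma metricE w : metric X w = tangents w *m (tangents w)^T.
Proof. by rewrite gram_rows. Qed.

(** The metric is the Gram matrix of linearly independent vectors. *)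
Lemma metric_unit w : U w -> injective ('d X w) -> metric X w \in unitmx.
Proof.
move=> Uw inj; rewrite -row_free_unit; apply: inj_row_free => v.
rewrite metricE mulmxA => /(congr1 (mulmx^~ v^T)).
rewrite mul0mx -mulmxA -trmx_mul mul_row_tr => /(congr1 (fun A : 'M[R]_1 => A 0 0)).
rewrite !mxE eqxx => /dot_eq0 E; apply: inj; rewrite linear0 -E.
rewrite {1}(row_sum_delta v) linear_sum mulmx_sum_row; apply: eq_bigr => a _.
by rewrite linearZ /= rowK /partial deriveE //; apply: smooth_on_diff Uw.
Qed.

Lemma partial_metric c a b w : U w ->
  partial c (fun w' => metric X w' a b) w =
  dot (partial c (partial a X) w) (partial b X w) +
  dot (partial a X w) (partial c (partial b X) w).
Proof.
move=> Uw.
have -> : (fun w' => metric X w' a b) = (fun w' => dot (partial a X w') (partial b X w')).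
  by rewrite funeqE => w'; rewrite mxE.
have D a' := smooth_on_is_derive (smooth_on_partial Xs a') c Uw.
exact: (derive_val (is_derive := is_derive_dot (D a) (D b))).
Qed.

Lemma partialC a b w : U w -> partial a (partial b X) w = partial b (partial a X) w.
Proof.
move=> Uw; apply/rowP => c.
pose f2 a b w := partial a (partial b X) w 0 c.
have D a' b' w' : U w' -> is_derive w' (delta_mx 0 a') (fun w => partial b' X w 0 c) (f2 a' b' w').
  by move=> Uw'; apply: is_derive_coord; apply: smooth_on_is_derive Uw'; apply: smooth_on_partial.
have C a' b' : {for w, continuous (f2 a' b')}.
  apply: differentiable_continuous; apply: (@differentiable_comp _ _ _ _ (partial a' (partial b' X)) (fun M => M 0 c)).
    by apply: smooth_on_diff Uw; do 2 apply: smooth_on_partial.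
  exact: differentiable_coord.
apply: (@schwarz _ _ U (fun w => X w 0 c) (fun w => partial b X w 0 c) (fun w => partial a X w 0 c) (f2 a b) (f2 b a) (delta_mx 0 b) (delta_mx 0 a)) => // w' Uw'.
- by apply: is_derive_coord; apply: smooth_on_is_derive Uw'.
- by apply: is_derive_coord; apply: smooth_on_is_derive Uw'.
Qed.

(** By the symmetry of second derivatives, four of the six terms of the Koszul
    formula cancel: the Levi-Civita connection is the tangential part of the
    ambient second derivative. *)
Lemma christoffelE c a b w : U w ->
  christoffel X c a b w =
  \sum_d invmx (metric X w) c d * dot (partial d X w) (partial a (partial b X) w).
Proof.
have koszul (A B C G p1 p2 p3 q1 q2 q3 : R) : A = p1 + q1 -> B = p2 + q2 ->
    C = p3 + q3 -> q2 = q1 -> p1 = p3 -> p2 = q3 ->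
    2^-1 * (G * (A + B - C)) = G * q1.
  by move=> -> -> -> -> -> ->; field.
move=> Uw; rewrite /christoffel big_distrr /=; apply: eq_bigr => d _.
apply: koszul (partial_metric a d b Uw) (partial_metric b d a Uw) (partial_metric d a b Uw) _ _ _.
- exact: (congr1 (dot _) (partialC b a Uw)).
- exact: (congr1 (fun v => dot v (partial b X w)) (partialC a d Uw)).
- exact: etrans (congr1 (fun v => dot v (partial a X w)) (partialC b d Uw)) (dotC _ _).
Qed.

Lemma dot_X_partial a w : U w -> dot (partial a X w) (X w) = 0.
Proof.
move=> Uw.
have D := is_derive_dot (smooth_on_is_derive Xs a Uw) (smooth_on_is_derive Xs a Uw).
have := is_derive_cst_on oU Uw Xsph D; rewrite [dot (X w) _]dotC => /eqP.
by rewrite -mulr2n mulrn_eq0 /= => /eqP.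
Qed.

Lemma dot_X_partial2 a b w : U w ->
  dot (partial a (partial b X) w) (X w) = - metric X w a b.
Proof.
move=> Uw.
have D := is_derive_dot (smooth_on_is_derive (smooth_on_partial Xs b) a Uw) (smooth_on_is_derive Xs a Uw).
have := is_derive_cst_on oU Uw (dot_X_partial b) D; rewrite (dotC (partial b X w) (partial a X w)) mxE => /eqP.
by rewrite addr_eq0 => /eqP.
Qed.

(** The tangent vectors and the position span at most n + 1 of the n + 2
    dimensions. *)
Lemma unit_normal_exists w : exists nu, is_unit_normal X w nu.
Proof.
pose A := col_mx (tangents w) (X w).
have : kermx A^T != 0.
  rewrite -mxrank_eq0 mxrank_ker subn_eq0 -ltnNge mxrank_tr.
  by apply: leq_ltn_trans (rank_leq_row A) _; rewrite -dim [(n + 1 + 1)%N]addn1.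
move/rowV0Pn => [v /sub_kermxP]; rewrite tr_col_mx mul_mx_row => /eqP.
rewrite -row_mx0 => /eqP/eq_row_mx[vT vX] v0.
have vv0 : 0 < dot v v.
  rewrite lt_neqAle dot_ge0 andbT eq_sym; apply: contra v0 => /eqP/dot_eq0 ->.
  by rewrite eqxx.
exists ((Num.sqrt (dot v v))^-1 *: v); split.
- rewrite dotZl dotZr mulrA -invfM -expr2 sqr_sqrtr ?mulVf ?gt_eqF //.
  exact: ltW.
- by rewrite dotZl [dot v (X w)]dotE vX mxE mulr0.
- move=> a; rewrite dotZl; have := vT.
  by rewrite mul_tr_rows => /rowP /(_ a); rewrite !mxE => ->; rewrite mulr0.
Qed.

Lemma unit_normalP w : is_unit_normal X w (unit_normal X w).
Proof. exact: (getPex (unit_normal_exists w)). Qed.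

(** The rows of the square matrix (X_a, nu, X) have Gram matrix diag (g, 1, 1);
    inverting it on the other side resolves the identity of the ambient space. *)
Lemma frame_complete w nu : U w -> metric X w \in unitmx -> is_unit_normal X w nu ->
  (tangents w)^T *m invmx (metric X w) *m tangents w + nu^T *m nu + (X w)^T *m X w = 1%:M.
Proof.
move=> Uw gU [nn nX nT].
pose B := col_mx (col_mx (tangents w) nu) (X w).
have TX : tangents w *m (X w)^T = 0.
  by rewrite mul_rows_tr; apply/colP => a; rewrite !mxE dot_X_partial.
have Tn : tangents w *m nu^T = 0.
  by rewrite mul_rows_tr; apply/colP => a; rewrite !mxE dotC nT.
have XT : X w *m (tangents w)^T = 0 by rewrite -[LHS]trmxK trmx_mul trmxK TX trmx0.
have nT' : nu *m (tangents w)^T = 0 by rewrite -[LHS]trmxK trmx_mul trmxK Tn trmx0.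
have BB : B *m B^T = diag3 (metric X w) 1%:M 1%:M.
  rewrite /B !tr_col_mx !(mul_col_mx, mul_mx_row) -metricE Tn TX.
  rewrite !mul_row_tr nn nX Xsph // [dot (X w) nu]dotC nX.
  by rewrite XT nT' /diag3 !block_mxEv !raddf0 row_col0 row_mx0.
have : B *m (B^T *m diag3 (invmx (metric X w)) 1%:M 1%:M) = 1%:M.
  rewrite mulmxA BB /diag3 !(mulmx_block, mulmx0, mul0mx, addr0, add0r, mulmx1).
  by rewrite mulmxV // -!scalar_mx_block.
move/(mulmx1C_eqdim dim).
rewrite /B /diag3 !tr_col_mx !(mul_row_block, mulmx0, mul0mx, addr0, add0r, mulmx1).
by rewrite !mul_row_col.
Qed.

Lemma dot_frame w nu (u v : 'rV[R]_N) :
  U w -> metric X w \in unitmx -> is_unit_normal X w nu ->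
  dot u v = \sum_c \sum_d invmx (metric X w) c d * dot (partial d X w) v * dot u (partial c X w)
            + dot u nu * dot v nu + dot u (X w) * dot v (X w).
Proof.
move=> Uw gU nuP; rewrite {1}dotE -{1}[u]mulmx1 -(frame_complete Uw gU nuP).
rewrite !mulmxDr !mulmxDl !mulmxA !mul_row_tr !mul_scalar_mx !dotZl !mxE !mulr1n.
rewrite [dot nu v]dotC [dot (X w) v]dotC.
congr (_ + _ + _); rewrite dotE -mulmxA mul_rows_tr mxE exchange_big /=.
apply: eq_bigr => d _; rewrite !mxE mulr_suml; apply: eq_bigr => c _.
by rewrite mul_tr_rows mxE [dot u _ * _]mulrC mulrAC.
Qed.

(** Differentiating u_b = G . X_b gives G_a . X_b + G . X_ab, and the Christoffel
    term removes the tangential part of X_ab.  There remain its part along the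
    normal and its part along X, which is - g_ab because X has unit length. *)
Lemma hessian_along (u : 'rV[R]_n -> R) (G : 'rV[R]_n -> 'rV[R]_N)
    (dG : 'I_n -> 'rV[R]_N) w :
  U w -> injective ('d X w) ->
  (forall w' a, U w' -> is_derive w' (delta_mx 0 a) u (dot (G w') (partial a X w'))) ->
  (forall a, is_derive w (delta_mx 0 a) G (dG a)) ->
  forall a b, hessian X u w a b =
    dot (dG a) (partial b X w) + dot (G w) (unit_normal X w) * second_form X w a b
    - dot (G w) (X w) * metric X w a b.
Proof.
move=> Uw inj Du DG a b.
have gU := metric_unit Uw inj.
have nuP := unit_normalP w.
have u1 c w' : U w' -> partial c u w' = dot (G w') (partial c X w').
  by move=> Uw'; apply: (derive_val (is_derive := Du w' c Uw')).
have u2 : partial a (partial b u) w = dot (dG a) (partial b X w) + dot (G w) (partial a (partial b X) w).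
  rewrite {1}/partial (@near_eq_derive _ _ _ _ (fun w => dot (G w) (partial b X w))).
    by apply: derive_val; apply: is_derive_dot => //; apply: smooth_on_is_derive Uw; apply: smooth_on_partial.
  by near=> w'; apply: u1; near: w'; apply: open_nbhs_nbhs.
rewrite mxE u2 (dot_frame (G w) (partial a (partial b X) w) Uw gU nuP).
rewrite (dot_X_partial2 a b Uw) [second_form _ _ _ _]mxE.
have -> : \sum_c christoffel X c a b w * partial c u w =
   \sum_c \sum_d invmx (metric X w) c d * dot (partial d X w) (partial a (partial b X) w) * dot (G w) (partial c X w).
  apply: eq_bigr => c _; rewrite (christoffelE c a b Uw) (u1 c w Uw) mulr_suml; exact: eq_bigr.
move: (\sum_c _) (metric _ _ _ _) => S g0; ring.
Unshelve. all: by end_near. Qed.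

Lemma laplacian_along (u : 'rV[R]_n -> R) (G : 'rV[R]_n -> 'rV[R]_N)
    (dG : 'I_n -> 'rV[R]_N) w :
  U w -> injective ('d X w) ->
  (forall w' a, U w' -> is_derive w' (delta_mx 0 a) u (dot (G w') (partial a X w'))) ->
  (forall a, is_derive w (delta_mx 0 a) G (dG a)) ->
  laplacian X u w =
    \tr (invmx (metric X w) *m \matrix_(a, b) dot (dG a) (partial b X w))
    + dot (G w) (unit_normal X w) * mean_curvature X w - n%:R * dot (G w) (X w).
Proof.
move=> Uw inj Du DG; rewrite /laplacian.
have -> : hessian X u w = \matrix_(a, b) dot (dG a) (partial b X w)
   + dot (G w) (unit_normal X w) *: second_form X w + (- dot (G w) (X w)) *: metric X w.
  by apply/matrixP => a b; rewrite (hessian_along Uw inj Du DG) !mxE mulNr.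
rewrite !mulmxDr !mxtraceD -!scalemxAr !mxtraceZ mulVmx ?metric_unit // mxtrace1.
by rewrite mulNr [_ * n%:R]mulrC.
Qed.



End Hypersurface.

(** The squared norm does not depend on how the roots of the characteristic
    polynomial are listed, so any factorization into linear factors gives it. *)
Lemma norm2_A_char_poly (R : realType) (n N : nat) (X : 'rV[R]_n -> 'rV[R]_N) x (s : seq R) :
  char_poly (shape_operator X x) = \prod_(c <- s) ('X - c%:P) ->
  norm2_A X x = \sum_(c <- s) c ^+ 2.
Proof.
move=> sE.
have sz : size s = n.
  have := congr1 (fun P : {poly R} => size P) sE.
  by rewrite size_char_poly size_prod_XsubC => -[].
have : is_principal_curvatures X x (principal_curvatures X x).
  apply: getPex; exists (\row_a s`_a); rewrite /is_principal_curvatures sE.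
  rewrite (big_nth 0) big_mkord sz; apply: eq_bigr => a _; by rewrite mxE.
rewrite /is_principal_curvatures sE => E.
pose s' := [seq principal_curvatures X x 0 a | a <- index_enum 'I_n].
have /prod_XsubC_eq ss' : \prod_(c <- s) ('X - c%:P) = \prod_(c <- s') ('X - c%:P).
  by rewrite E /s' big_map.
by rewrite (perm_big _ ss') /= /s' big_map.
Qed.

(** * Warped sphere factors *)

(** One factor r (t) y of the immersion.  The functions y and t of the parameters
    come with their first and second derivatives as separate data, so that both
    sphere factors are instances. *)
Section WarpedSphere.
Variables (R : realType) (n m : nat) (U : set 'rV[R]_n).
Variables (y : 'rV[R]_n -> 'rV[R]_m) (dy : 'I_n -> 'rV[R]_n -> 'rV[R]_m).
Variable d2y : 'I_n -> 'I_n -> 'rV[R]_n -> 'rV[R]_m.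
Variables (t : 'rV[R]_n -> R) (dt : 'I_n -> 'rV[R]_n -> R).
Variable d2t : 'I_n -> 'I_n -> 'rV[R]_n -> R.
Variables r dr d2r : R -> R.
Hypothesis oU : open U.
Hypothesis ysph : forall w, U w -> dot (y w) (y w) = 1.
Hypothesis Dy : forall a w, U w -> is_derive w (delta_mx 0 a) y (dy a w).
Hypothesis D2y : forall a b w, U w -> is_derive w (delta_mx 0 a) (dy b) (d2y a b w).
Hypothesis Dt : forall a w, U w -> is_derive w (delta_mx 0 a) t (dt a w).
Hypothesis D2t : forall a b w, U w -> is_derive w (delta_mx 0 a) (dt b) (d2t a b w).
Hypothesis Dr : forall s : R, is_derive s 1 r (dr s).
Hypothesis D2r : forall s : R, is_derive s 1 dr (d2r s).

Lemma dot_sphere_partial a w : U w -> dot (dy a w) (y w) = 0.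
Proof.
move=> Uw; have D := is_derive_dot (Dy a Uw) (Dy a Uw).
have := is_derive_cst_on oU Uw ysph D; rewrite (dotC (y w)) => /eqP.
by rewrite -mulr2n mulrn_eq0 /= => /eqP.
Qed.

Lemma dot_sphere_partial2 a b w : U w ->
  dot (d2y a b w) (y w) = - dot (dy a w) (dy b w).
Proof.
move=> Uw; have D := is_derive_dot (D2y a b Uw) (Dy a Uw).
have := is_derive_cst_on oU Uw (fun w Uw => dot_sphere_partial b Uw) D.
by rewrite (dotC (dy b w)) => /eqP; rewrite addr_eq0 => /eqP.
Qed.

Definition warp1 a w := r (t w) *: dy a w + (dr (t w) * dt a w) *: y w.

Lemma is_derive_warp a w : U w ->
  is_derive w (delta_mx 0 a) (fun w => r (t w) *: y w) (warp1 a w).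
Proof.
move=> Uw; apply: is_derive_scale (Dy a Uw).
exact: (is_derive_compR (Dr (t w)) (Dt a Uw)).
Qed.

(** Of the second derivative of r (t) y only the component along y matters, since
    the unit normal has no other component in this factor. *)
Lemma is_derive_warp1 a b w : U w -> exists2 d,
  is_derive w (delta_mx 0 a) (warp1 b) d &
  dot d (y w) = - (r (t w) * dot (dy a w) (dy b w))
     + d2r (t w) * (dt a w * dt b w) + dr (t w) * d2t a b w.
Proof.
move=> Uw; eexists.
  apply: is_deriveD.
    by apply: is_derive_scale (D2y a b Uw); apply: (is_derive_compR (Dr (t w)) (Dt a Uw)).
  apply: is_derive_scale (Dy a Uw); apply: is_derive_mul (D2t a b Uw).
  exact: (is_derive_compR (D2r (t w)) (Dt a Uw)).
rewrite /= !dotDl !dotZl !dot_sphere_partial // dot_sphere_partial2 // ysph //.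
ring.
Qed.

Lemma dot_warp1 a b w : U w -> dot (warp1 a w) (warp1 b w) =
  r (t w) ^+ 2 * dot (dy a w) (dy b w) + dr (t w) ^+ 2 * (dt a w * dt b w).
Proof.
move=> Uw; rewrite /warp1 !(dotDl, dotDr, dotZl, dotZr) dot_sphere_partial //.
rewrite (dotC (y w) (dy b w)) dot_sphere_partial // ysph //; ring.
Qed.

Lemma dot_warp1_base a w : U w -> dot (y w) (warp1 a w) = dr (t w) * dt a w.
Proof.
move=> Uw; rewrite /warp1 !(dotDr, dotZr) ysph // (dotC (y w)) dot_sphere_partial //.
ring.
Qed.

Lemma dot_warp1_partial a b w : U w ->
  dot (dy a w) (warp1 b w) = r (t w) * dot (dy a w) (dy b w).
Proof.
by move=> Uw; rewrite /warp1 !(dotDr, dotZr) dot_sphere_partial // mulr0 addr0.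
Qed.

Variables (i : 'I_m) (c : R).

(** For c = m, the gradient at r y of the Kelvin transform |Y|^(-m) Y_i is
    r^(-m) times this vector. *)
Definition kelvin_dir (w : 'rV[R]_n) : 'rV[R]_m := delta_mx 0 i - (c * y w 0 i) *: y w.

Lemma dot_kelvin_dir_warp1 a w : U w -> dot (kelvin_dir w) (warp1 a w) =
  r (t w) * dy a w 0 i + (1 - c) * (dr (t w) * dt a w) * y w 0 i.
Proof.
move=> Uw; rewrite /kelvin_dir dotDl dotNl dotZl dot_delta dot_warp1_base //.
rewrite /warp1 !mxE; ring.
Qed.

Lemma dot_kelvin_dir_base w : U w -> dot (kelvin_dir w) (y w) = (1 - c) * y w 0 i.
Proof.
move=> Uw; rewrite /kelvin_dir dotDl dotNl dotZl dot_delta ysph //; ring.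
Qed.

Lemma is_derive_kelvin_dir a w : U w -> exists2 d,
  is_derive w (delta_mx 0 a) kelvin_dir d &
  forall b, dot d (warp1 b w) =
   - c * (dy a w 0 i * (dr (t w) * dt b w) + y w 0 i * (r (t w) * dot (dy a w) (dy b w))).
Proof.
move=> Uw.
have H0 := is_derive_cst (delta_mx 0 i : 'rV[R]_m) w (delta_mx 0 a).
have Hc := is_derive_mul (is_derive_cst c w (delta_mx 0 a)) (is_derive_coord 0 i (Dy a Uw)).
have H := is_deriveB H0 (is_derive_scale Hc (Dy a Uw)).
exists (0 - ((c * y w 0 i) *: dy a w + (0 * y w 0 i + c * dy a w 0 i) *: y w)).
  exact: H.
move=> b; rewrite sub0r dotNl !dotDl !dotZl dot_warp1_partial // dot_warp1_base //.
by rewrite /= ; ring.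
Qed.
End WarpedSphere.

(** * Two identities for the profile curve *)

(** The position, the velocity and the normal of the profile curve are orthogonal;
    these are entries of M^T diag (1, 1/q, 1) M = 1 for the matrix M of rows. *)
Lemma orthogonal_frame3 (F : fieldType) (x1 x2 x3 d1 d2 d3 A B C q : F) :
  q != 0 ->
  x1 ^+ 2 + x2 ^+ 2 + x3 ^+ 2 = 1 -> d1 ^+ 2 + d2 ^+ 2 + d3 ^+ 2 = q ->
  A ^+ 2 + B ^+ 2 + C ^+ 2 = 1 -> x1 * d1 + x2 * d2 + x3 * d3 = 0 ->
  A * x1 + B * x2 + C * x3 = 0 -> d1 * A + d2 * B + d3 * C = 0 ->
  [/\ x1 ^+ 2 + d1 ^+ 2 / q + A ^+ 2 = 1, x1 * x2 + d1 * d2 / q + A * B = 0 &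
      x2 ^+ 2 + d2 ^+ 2 / q + B ^+ 2 = 1].
Proof.
move=> q0 xx dd nn xd nx dn.
pose rows (s : seq (seq F)) : 'M[F]_3 := \matrix_(i, j) nth 0 (nth [::] s i) j.
pose M := rows [:: [:: x1; x2; x3]; [:: d1; d2; d3]; [:: A; B; C]].
pose M' := rows [:: [:: x1; d1 / q; A]; [:: x2; d2 / q; B]; [:: x3; d3 / q; C]].
have MM' : M *m M' = 1%:M.
  apply/matrixP => i j; rewrite !mxE !big_ord_recr big_ord0 /= !mxE /=.
  case: i => [[|[|[|i]]] hi] //; case: j => [[|[|[|j]]] hj] //=; rewrite ?mulr1n ?mulr0n ?add0r.
  - by rewrite -xx; ring.
  - transitivity ((x1 * d1 + x2 * d2 + x3 * d3) / q); first by field.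
    by rewrite xd mul0r.
  - by rewrite -nx; ring.
  - by rewrite -xd; ring.
  - transitivity ((d1 ^+ 2 + d2 ^+ 2 + d3 ^+ 2) / q); first by field.
    by rewrite dd divff.
  - by rewrite -dn; ring.
  - by rewrite -nx; ring.
  - transitivity ((d1 * A + d2 * B + d3 * C) / q); first by field.
    by rewrite dn mul0r.
  - by rewrite -nn; ring.
have /matrixP E := mulmx1C MM'.
have E00 := E 0 0; have E10 := E 1 0; have E11 := E 1 1.
move: E00 E10 E11; rewrite !mxE !big_ord_recr !big_ord0 /= !mxE /= ?mulr1n ?mulr0n ?add0r.
by move=> e00 e10 e11; split; [rewrite -e00|rewrite -e10|rewrite -e11]; field.
Qed.

(** On the right stands minus the Laplacian of u = om yi zj, as a sum of the two traces
    coming from the sphere factors and of the term (K + L + 1)(K + L) u coming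
    from the homogeneity of the ambient function.  The products of the d's are
    eliminated with the orthogonality relations, and k3 with minimality. *)
Lemma rotational_identity (R : realFieldType) (K L k1 k2 k3 A B q x1 x2 d1 d2 om yi zj : R) :
  x1 != 0 -> x2 != 0 -> q != 0 ->
  x1 ^+ 2 + d1 ^+ 2 / q + A ^+ 2 = 1 -> x1 * x2 + d1 * d2 / q + A * B = 0 ->
  x2 ^+ 2 + d2 ^+ 2 / q + B ^+ 2 = 1 ->
  k1 = - A / x1 -> k2 = - B / x2 -> K * k1 + L * k2 + k3 = 0 ->
  (K * k1 ^+ 2 + L * k2 ^+ 2 + k3 ^+ 2) * (om * yi * zj) =
  - (- K * d1 * yi * (- (((K + 1) * d1 / x1 + L * d2 / x2) * (om / x1)) * zj) / q
  - (K + 1) * (om / x1 * zj) * yi * x1 * (K / x1 ^+ 2)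
  + (- L * d2 * zj * (- ((K * d1 / x1 + (L + 1) * d2 / x2) * (om / x2)) * yi) / q
  - (L + 1) * (om / x2 * yi) * zj * x2 * (L / x2 ^+ 2))
  + (K + L + 1) * (K + L) * (om * yi * zj)).
Proof.
move=> x10 x20 q0 E11 E12 E22 k1E k2E H.
have -> : k3 = - (K * k1 + L * k2) by rewrite -[k3](addKr (K * k1 + L * k2)) H addr0.
have D11 : d1 ^+ 2 = q * (1 - x1 ^+ 2 - A ^+ 2) by rewrite -E11; field.
have D22 : d2 ^+ 2 = q * (1 - x2 ^+ 2 - B ^+ 2) by rewrite -E22; field.
have D12 : d1 * d2 = - q * (x1 * x2 + A * B).
  by apply/eqP; rewrite -subr_eq0; apply/eqP; transitivity (q * (x1 * x2 + d1 * d2 / q + A * B)); [field | rewrite E12 mulr0].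
symmetry; transitivity (- (om * yi * zj) * (
   (K * (K + 1) * d1 ^+ 2 / x1 ^+ 2 + 2 * K * L * (d1 * d2) / (x1 * x2)
    + L * (L + 1) * d2 ^+ 2 / x2 ^+ 2) / q
   - K * (K + 1) / x1 ^+ 2 - L * (L + 1) / x2 ^+ 2 + (K + L + 1) * (K + L))).
  by field; rewrite x10 x20 q0.
by rewrite D11 D22 D12 k1E k2E; field; rewrite x10 x20 q0.
Qed.

(** * Rotational hypersurfaces *)

(** The profile curve is (r1, r2, r3), and (y, z, t) is an arbitrary
    parametrization of the product of the spheres and the line. *)
Section Rotational.
Variables (R : realType) (n k l : nat).
Hypothesis dim : n = (k + l + 1)%N.
Variable U : set 'rV[R]_n.
Hypothesis oU : open U.
Variables (y : 'rV[R]_n -> 'rV[R]_k.+1) (dy : 'I_n -> 'rV[R]_n -> 'rV[R]_k.+1).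
Variable d2y : 'I_n -> 'I_n -> 'rV[R]_n -> 'rV[R]_k.+1.
Variables (z : 'rV[R]_n -> 'rV[R]_l.+1) (dz : 'I_n -> 'rV[R]_n -> 'rV[R]_l.+1).
Variable d2z : 'I_n -> 'I_n -> 'rV[R]_n -> 'rV[R]_l.+1.
Variables (t : 'rV[R]_n -> R) (dt : 'I_n -> 'rV[R]_n -> R).
Variable d2t : 'I_n -> 'I_n -> 'rV[R]_n -> R.
Variables r1 dr1 d2r1 r2 dr2 d2r2 r3 dr3 d2r3 : R -> R.
Hypothesis ysph : forall w, U w -> dot (y w) (y w) = 1.
Hypothesis zsph : forall w, U w -> dot (z w) (z w) = 1.
Hypothesis Dy : forall a w, U w -> is_derive w (delta_mx 0 a) y (dy a w).
Hypothesis D2y : forall a b w, U w -> is_derive w (delta_mx 0 a) (dy b) (d2y a b w).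
Hypothesis Dz : forall a w, U w -> is_derive w (delta_mx 0 a) z (dz a w).
Hypothesis D2z : forall a b w, U w -> is_derive w (delta_mx 0 a) (dz b) (d2z a b w).
Hypothesis Dt : forall a w, U w -> is_derive w (delta_mx 0 a) t (dt a w).
Hypothesis D2t : forall a b w, U w -> is_derive w (delta_mx 0 a) (dt b) (d2t a b w).
Hypothesis Dr1 : forall s : R, is_derive s 1 r1 (dr1 s).
Hypothesis D2r1 : forall s : R, is_derive s 1 dr1 (d2r1 s).
Hypothesis Dr2 : forall s : R, is_derive s 1 r2 (dr2 s).
Hypothesis D2r2 : forall s : R, is_derive s 1 dr2 (d2r2 s).
Hypothesis Dr3 : forall s : R, is_derive s 1 r3 (dr3 s).
Hypothesis D2r3 : forall s : R, is_derive s 1 dr3 (d2r3 s).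
Hypothesis r1_neq0 : forall s, r1 s != 0.
Hypothesis r2_neq0 : forall s, r2 s != 0.
Hypothesis rsph : forall s, r1 s ^+ 2 + r2 s ^+ 2 + r3 s ^+ 2 = 1.

Definition rotX w : 'rV[R]_(k.+1 + l.+1 + 1) :=
  row_mx (row_mx (r1 (t w) *: y w) (r2 (t w) *: z w)) (r3 (t w))%:M.

Hypothesis Xs : smooth_on U rotX.

Definition speed2 s := dr1 s ^+ 2 + dr2 s ^+ 2 + dr3 s ^+ 2.

Let wy := warp1 y dy t dt r1 dr1.
Let wz := warp1 z dz t dt r2 dr2.

Lemma profile_orth s : r1 s * dr1 s + r2 s * dr2 s + r3 s * dr3 s = 0.
Proof.
have sq (r dr : R -> R) : (forall s : R, is_derive s 1 r (dr s)) ->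
    is_derive s 1 (fun s => r s * r s) (dr s * r s + r s * dr s).
  by move=> D; apply: is_derive_mul.
have D := is_deriveD (is_deriveD (sq _ _ Dr1) (sq _ _ Dr2)) (sq _ _ Dr3).
have := is_derive_cst_on (@openT R) (I : setT s) _ D => /(_ 1) E.
have {}E := E (fun w _ => rsph w).
apply: (@mulfI _ 2); first by rewrite pnatr_eq0.
rewrite mulr0 -[RHS]E; ring.
Qed.

Lemma rotX_sphere w : U w -> dot (rotX w) (rotX w) = 1.
Proof.
move=> Uw; rewrite /rotX !dot_row_mx dot_scalar_mx !(dotZl, dotZr) ysph // zsph //.
by rewrite -[RHS](rsph (t w)); ring.
Qed.

Lemma is_derive_rotX a w : U w ->
  is_derive w (delta_mx 0 a) rotX (row_mx (row_mx (wy a w) (wz a w)) (dr3 (t w) * dt a w)%:M).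
Proof.
move=> Uw; apply: is_derive_row_mx.
  apply: is_derive_row_mx; first exact: (is_derive_warp Dy Dt Dr1).
  exact: (is_derive_warp Dz Dt Dr2).
by apply: is_derive_scalar_mx; apply: (is_derive_compR (Dr3 _) (Dt a Uw)).
Qed.

Lemma partial_rotX a w : U w ->
  partial a rotX w = row_mx (row_mx (wy a w) (wz a w)) (dr3 (t w) * dt a w)%:M.
Proof. by move=> Uw; apply: (derive_val (is_derive := is_derive_rotX a Uw)). Qed.

Lemma dot_partial_rotX a w u v c : U w ->
  dot (row_mx (row_mx u v) c%:M) (partial a rotX w) =
  dot u (wy a w) + dot v (wz a w) + c * (dr3 (t w) * dt a w).
Proof. by move=> Uw; rewrite partial_rotX // !dot_row_mx dot_scalar_mx. Qed.

Let Vm w : 'M[R]_(n, k.+1) := \matrix_a dy a w.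
Let Wm w : 'M[R]_(n, l.+1) := \matrix_a dz a w.
Let tm w : 'cV[R]_n := \col_a dt a w.

Lemma metric_rotX w : U w -> metric rotX w =
  (r1 (t w) ^+ 2) *: (Vm w *m (Vm w)^T) + (r2 (t w) ^+ 2) *: (Wm w *m (Wm w)^T)
  + speed2 (t w) *: (tm w *m (tm w)^T).
Proof.
move=> Uw; apply/matrixP => a b.
rewrite !gram_rows mxE partial_rotX // dot_partial_rotX //.
rewrite (dot_warp1 t dt r1 dr1 oU ysph Dy) // (dot_warp1 t dt r2 dr2 oU zsph Dz) //.
rewrite !mxE big_ord_recr big_ord0 /= !mxE /speed2; ring.
Qed.

(** The condition on (A, B, c) is orthogonality to the velocity of the profile; it
    removes the second derivatives of t. *)
Lemma dot_partial2_rotX a b w A B c : U w ->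
  dr1 (t w) * A + dr2 (t w) * B + dr3 (t w) * c = 0 ->
  dot (partial a (partial b rotX) w) (row_mx (row_mx (A *: y w) (B *: z w)) c%:M) =
  - (A * r1 (t w)) * dot (dy a w) (dy b w) - (B * r2 (t w)) * dot (dz a w) (dz b w)
  + (d2r1 (t w) * A + d2r2 (t w) * B + d2r3 (t w) * c) * (dt a w * dt b w).
Proof.
move=> Uw m0.
have [d1 H1 E1] := is_derive_warp1 oU ysph Dy D2y Dt D2t Dr1 D2r1 a b Uw.
have [d2 H2 E2] := is_derive_warp1 oU zsph Dz D2z Dt D2t Dr2 D2r2 a b Uw.
have H3 : is_derive w (delta_mx 0 a) (fun w => dr3 (t w) * dt b w)
    (d2r3 (t w) * dt a w * dt b w + dr3 (t w) * d2t a b w).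
  by apply: is_derive_mul (D2t a b Uw); apply: (is_derive_compR (D2r3 _) (Dt a Uw)).
have H := is_derive_row_mx (is_derive_row_mx H1 H2) (is_derive_scalar_mx H3).
have -> : partial a (partial b rotX) w = row_mx (row_mx d1 d2)
    (d2r3 (t w) * dt a w * dt b w + dr3 (t w) * d2t a b w)%:M.
  rewrite -[RHS](derive_val (is_derive := H)); apply: near_eq_derive.
  by near=> w'; apply: partial_rotX; near: w'; apply: open_nbhs_nbhs.
rewrite !dot_row_mx dot_scalar_mx !dotZr E1 E2.
transitivity (- (A * r1 (t w)) * dot (dy a w) (dy b w) - (B * r2 (t w)) * dot (dz a w) (dz b w)
  + (d2r1 (t w) * A + d2r2 (t w) * B + d2r3 (t w) * c) * (dt a w * dt b w) +
  (dr1 (t w) * A + dr2 (t w) * B + dr3 (t w) * c) * d2t a b w); first by ring.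
by rewrite m0 mul0r addr0.
Unshelve. all: by end_near. Qed.

Lemma dim_ambient : (n + 1 + 1 = k.+1 + l.+1 + 1)%N.
Proof. by rewrite dim; lia. Qed.

Variable x : 'rV[R]_n.
Hypothesis Ux : U x.
Hypothesis inj : injective ('d rotX x).

Let s := t x.
Let gU : metric rotX x \in unitmx := metric_unit Xs Ux inj.
Let gE := metric_rotX Ux.
Let a0 : r1 s ^+ 2 != 0. Proof. by rewrite expf_neq0. Qed.
Let b0 : r2 s ^+ 2 != 0. Proof. by rewrite expf_neq0. Qed.

Let Vy : Vm x *m (y x)^T = 0.
Proof.
by rewrite mul_rows_tr; apply/colP => a; rewrite !mxE (dot_sphere_partial oU ysph Dy).
Qed.

Let Wz : Wm x *m (z x)^T = 0.
Proof.
by rewrite mul_rows_tr; apply/colP => a; rewrite !mxE (dot_sphere_partial oU zsph Dz).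
Qed.

Let yy : y x *m (y x)^T = 1%:M.
Proof. by rewrite mul_row_tr ysph. Qed.

Let zz : z x *m (z x)^T = 1%:M.
Proof. by rewrite mul_row_tr zsph. Qed.

Lemma unit_normal_rotX : exists A B c,
  [/\ unit_normal rotX x = row_mx (row_mx (A *: y x) (B *: z x)) c%:M,
      A ^+ 2 + B ^+ 2 + c ^+ 2 = 1, A * r1 s + B * r2 s + c * r3 s = 0 &
      dr1 s * A + dr2 s * B + dr3 s * c = 0].
Proof.
have [nn nX nT] := unit_normalP dim_ambient rotX x.
set nu := unit_normal rotX x in nn nX nT *.
pose u := lsubmx (lsubmx nu); pose v := rsubmx (lsubmx nu); pose c := rsubmx nu 0 0.
have nuE : nu = row_mx (row_mx u v) c%:M by rewrite /u /v /c -mx11_scalar !hsubmxK.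
pose A := dot u (y x); pose B := dot v (z x).
have E : r1 s *: (Vm x *m u^T) + r2 s *: (Wm x *m v^T)
    + (dr1 s * A + dr2 s * B + dr3 s * c) *: tm x = 0.
  rewrite !mul_rows_tr; apply/colP => a; rewrite !mxE -[RHS](nT a) nuE dot_partial_rotX //.
  rewrite /wy /wz /warp1 !(dotDr, dotZr) (dotC u (dy a x)) (dotC v (dz a x)) /A /B /s.
  by ring.
have [uE vE m0] := prod_frame_kernel dim_ambient a0 b0 Vy Wz yy zz gE gU (r1_neq0 s) (r2_neq0 s) E.
have {}uE : u = A *: y x by rewrite uE mul_row_tr mul_scalar_mx.
have {}vE : v = B *: z x by rewrite vE mul_row_tr mul_scalar_mx.
exists A, B, c; split; first by rewrite nuE uE vE.
- move: nn; rewrite nuE !dot_row_mx dot_scalar_mx uE vE !(dotZl, dotZr) ysph // zsph // => <-.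
  by ring.
- move: nX; rewrite nuE !dot_row_mx dot_scalar_mx uE vE !(dotZl, dotZr) ysph // zsph // => <-.
  by rewrite /s; ring.
- by [].
Qed.

(** The numbers A and B are the first two coordinates of the normal of the profile
    curve; k3 is its geodesic curvature. *)
Lemma curvatures_rotX : exists A B k1 k2 k3,
  [/\ second_form rotX x = (k1 * r1 s ^+ 2) *: (Vm x *m (Vm x)^T)
        + (k2 * r2 s ^+ 2) *: (Wm x *m (Wm x)^T) + (k3 * speed2 s) *: (tm x *m (tm x)^T),
      k1 = - A / r1 s, k2 = - B / r2 s &
     [/\ r1 s ^+ 2 + dr1 s ^+ 2 / speed2 s + A ^+ 2 = 1,
         r1 s * r2 s + dr1 s * dr2 s / speed2 s + A * B = 0 &
         r2 s ^+ 2 + dr2 s ^+ 2 / speed2 s + B ^+ 2 = 1]].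
Proof.
have [A [B [c [nuE nn nX nT]]]] := unit_normal_rotX.
have [q0 _ _ _] := trace_invmx_blocks dim_ambient a0 b0 Vy Wz yy zz gE gU.
exists A, B, (- A / r1 s), (- B / r2 s).
exists ((d2r1 s * A + d2r2 s * B + d2r3 s * c) / speed2 s); split=> //.
  apply/matrixP => a b; rewrite mxE nuE (dot_partial2_rotX _ _ Ux nT) -/s.
  rewrite !gram_rows !mxE big_ord1 !mxE.
  by field; rewrite q0 r1_neq0 r2_neq0.
exact: (orthogonal_frame3 q0 (rsph s) erefl nn (profile_orth s) nX nT).
Qed.

Lemma curvature_sums_rotX k1 k2 k3 :
  second_form rotX x = (k1 * r1 s ^+ 2) *: (Vm x *m (Vm x)^T)
    + (k2 * r2 s ^+ 2) *: (Wm x *m (Wm x)^T) + (k3 * speed2 s) *: (tm x *m (tm x)^T) ->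
  norm2_A rotX x = k%:R * k1 ^+ 2 + l%:R * k2 ^+ 2 + k3 ^+ 2
  /\ mean_curvature rotX x = k%:R * k1 + l%:R * k2 + k3.
Proof.
move=> hE; split.
  rewrite (@norm2_A_char_poly _ _ _ _ _ (nseq k k1 ++ nseq l k2 ++ [:: k3])).
    by rewrite !big_cat big_seq1 /= !big_nseq !iter_addr_0 addrA -!(mulr_natl (_ ^+ 2)).
  rewrite (char_poly_prod_frame dim_ambient a0 b0 Vy Wz yy zz gE gU hE).
  by rewrite !big_cat big_seq1 /= !big_nseq !iter_mulr_1 mulrA.
have [q0 TV TW Tt] := trace_invmx_blocks dim_ambient a0 b0 Vy Wz yy zz gE gU.
rewrite /mean_curvature /shape_operator hE !mulmxDr !mxtraceD -!scalemxAr !mxtraceZ TV TW Tt.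
rewrite -/s; by field; rewrite q0 r1_neq0 r2_neq0.
Qed.

Definition rpow a b s := r1 s ^- a * r2 s ^- b.

Let drpow a b s := - ((a%:R * dr1 s / r1 s + b%:R * dr2 s / r2 s) * rpow a b s).

Lemma is_derive_rpow a b (s' : R) : is_derive s' 1 (rpow a b) (drpow a b s').
Proof.
have D1 := is_derive_powV a (r1_neq0 s') (Dr1 s').
have D2 := is_derive_powV b (r2_neq0 s') (Dr2 s').
apply: is_derive_eq (is_derive_mul D1 D2) _.
rewrite /drpow /rpow; ring.
Qed.

Variables (i : 'I_k.+1) (j : 'I_l.+1).

Let u w := rpow k l (t w) * y w 0 i * z w 0 j.

Let Ky := kelvin_dir y i k.+1%:R.
Let Kz := kelvin_dir z j l.+1%:R.
Let al w := rpow k.+1 l (t w) * z w 0 j.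
Let be w := rpow k l.+1 (t w) * y w 0 i.

(** The gradient of |Y|^(-k-1) Y_i |Z|^(-l-1) Z_j along the immersion. *)
Definition ambient_gradient w : 'rV[R]_(k.+1 + l.+1 + 1) :=
  row_mx (row_mx (al w *: Ky w) (be w *: Kz w)) 0%:M.

Lemma is_derive_mode a w : U w ->
  is_derive w (delta_mx 0 a) u (dot (ambient_gradient w) (partial a rotX w)).
Proof.
move=> Uw.
have Do := is_derive_compR (is_derive_rpow k l (t w)) (Dt a Uw).
have D := is_derive_mul (is_derive_mul Do (is_derive_coord 0 i (Dy a Uw))) (is_derive_coord 0 j (Dz a Uw)).
apply: is_derive_eq D _; rewrite dot_partial_rotX // !dotZl.
rewrite (dot_kelvin_dir_warp1 t dt r1 dr1 oU ysph Dy) // (dot_kelvin_dir_warp1 t dt r2 dr2 oU zsph Dz) //.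
rewrite /al /be /drpow /rpow !exprS -!natr1.
have H1 : r1 (t w) ^+ k != 0 by rewrite expf_neq0.
have H2 : r2 (t w) ^+ l != 0 by rewrite expf_neq0.
by field; rewrite H1 H2 r1_neq0 r2_neq0.
Qed.

Theorem stability_rotX : mean_curvature rotX x = 0 ->
  stability_operator rotX u x = - n%:R * u x.
Proof.
move=> H0.
have [A [B [k1 [k2 [k3 [hE k1E k2E [E11 E12 E22]]]]]]] := curvatures_rotX.
have [nA] := curvature_sums_rotX hE; rewrite H0 => /esym trE.
have [q0 TV TW Tt] := trace_invmx_blocks dim_ambient a0 b0 Vy Wz yy zz gE gU.
have [T1 T2 T3 T4 [T5 T6]] := trace_invmx_mixed dim_ambient a0 b0 Vy Wz yy zz gE gU i j.
have DG a : {dK : 'rV[R]_k.+1 * 'rV[R]_l.+1 | 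
   is_derive x (delta_mx 0 a) ambient_gradient
    (row_mx (row_mx (al x *: dK.1 + (drpow k.+1 l s * dt a x * z x 0 j + rpow k.+1 l s * dz a x 0 j) *: Ky x)
                    (be x *: dK.2 + (drpow k l.+1 s * dt a x * y x 0 i + rpow k l.+1 s * dy a x 0 i) *: Kz x)) 0%:M)
   & forall b, dot dK.1 (wy b x) = - k.+1%:R * (dy a x 0 i * (dr1 s * dt b x)
          + y x 0 i * (r1 s * dot (dy a x) (dy b x))) /\
      dot dK.2 (wz b x) = - l.+1%:R * (dz a x 0 j * (dr2 s * dt b x)
          + z x 0 j * (r2 s * dot (dz a x) (dz b x)))}.
  apply: cid2.
  have [d1 D1 E1] := is_derive_kelvin_dir t dt r1 dr1 oU ysph Dy i k.+1%:R a Ux.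
  have [d2 D2 E2] := is_derive_kelvin_dir t dt r2 dr2 oU zsph Dz j l.+1%:R a Ux.
  exists (d1, d2) => /=; last by move=> b; split; [exact: E1 | exact: E2].
  apply: is_derive_row_mx; last exact: (is_derive_scalar_mx (is_derive_cst (0 : R) x (delta_mx 0 a))).
  apply: is_derive_row_mx.
    apply: is_derive_scale D1; apply: is_derive_mul; last exact: is_derive_coord (Dz a Ux).
    exact: (is_derive_compR (is_derive_rpow _ _ (t x)) (Dt a Ux)).
  apply: is_derive_scale D2; apply: is_derive_mul; last exact: is_derive_coord (Dy a Ux).
  exact: (is_derive_compR (is_derive_rpow _ _ (t x)) (Dt a Ux)).
have L := laplacian_along dim_ambient oU Xs rotX_sphere Ux inj (fun w a => @is_derive_mode a w)
   (fun a => s2valP (DG a)).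
rewrite /stability_operator L H0 mulr0 addr0 nA.
(* Euler's relation for a function of degree - (k + l). *)
have GX : dot (ambient_gradient x) (rotX x) = - (k%:R + l%:R) * u x.
  rewrite /rotX /ambient_gradient !dot_row_mx dot_scalar_mx !(dotZl, dotZr).
  rewrite (dot_kelvin_dir_base ysph) // (dot_kelvin_dir_base zsph) // /al /be /u /rpow !exprS -!natr1 -/s.
  have H1 : r1 s ^+ k != 0 by rewrite expf_neq0.
  have H2 : r2 s ^+ l != 0 by rewrite expf_neq0.
  by field; rewrite H1 H2 r1_neq0 r2_neq0.
set P := \matrix_(_, _) _.
pose vi := col i (Vm x); pose wj := col j (Wm x).
(* Only the multiples of tm tm^T, Vm Vm^T and Wm Wm^T have a nonzero trace against
   the inverse metric: the other products mix two factors. *)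
have PE : P =
    (r1 s * drpow k.+1 l s * z x 0 j) *: (tm x *m vi^T) +
    (r1 s * rpow k.+1 l s) *: (wj *m vi^T) +
    (- k%:R * dr1 s * y x 0 i * drpow k.+1 l s * z x 0 j) *: (tm x *m (tm x)^T) +
    (- k%:R * dr1 s * y x 0 i * rpow k.+1 l s) *: (wj *m (tm x)^T) +
    (- (k%:R + 1) * al x * dr1 s) *: (vi *m (tm x)^T) +
    (- (k%:R + 1) * al x * y x 0 i * r1 s) *: (Vm x *m (Vm x)^T) +
   ((r2 s * drpow k l.+1 s * y x 0 i) *: (tm x *m wj^T) +
    (r2 s * rpow k l.+1 s) *: (vi *m wj^T) +
    (- l%:R * dr2 s * z x 0 j * drpow k l.+1 s * y x 0 i) *: (tm x *m (tm x)^T) +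
    (- l%:R * dr2 s * z x 0 j * rpow k l.+1 s) *: (vi *m (tm x)^T) +
    (- (l%:R + 1) * be x * dr2 s) *: (wj *m (tm x)^T) +
    (- (l%:R + 1) * be x * z x 0 j * r2 s) *: (Wm x *m (Wm x)^T)).
  apply/matrixP => a b; rewrite [LHS]mxE dot_partial_rotX // !(dotDl (_ *: _) (_ *: _)) !dotZl.
  have [-> ->] := s2valP' (DG a) b; rewrite /Ky /Kz /wy /wz.
  rewrite (dot_kelvin_dir_warp1 t dt r1 dr1 oU ysph Dy) // (dot_kelvin_dir_warp1 t dt r2 dr2 oU zsph Dz) //.
  rewrite !gram_rows !mxE !big_ord1 !mxE -/s -!natr1; ring.
rewrite PE !mulmxDr !mxtraceD -!scalemxAr !mxtraceZ T1 T2 T3 T4 T5 T6 TV TW Tt GX.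
have tgt := rotational_identity (rpow k l s) (y x 0 i) (z x 0 j) (r1_neq0 s) (r2_neq0 s) q0 E11 E12 E22 k1E k2E trE.
rewrite tgt dim !natrD -/s.
rewrite /al /be /u /drpow -/s.
have -> : rpow k.+1 l s = rpow k l s / r1 s by rewrite /rpow exprS invfM; ring.
have -> : rpow k l.+1 s = rpow k l s / r2 s by rewrite /rpow exprS invfM; ring.
rewrite -!natr1; field; rewrite q0 r1_neq0 r2_neq0 //.
Qed.

End Rotational.

(** * Derivatives of the data and conclusion *)

Lemma smooth_is_derive (R : realType) (f : R -> R) m (s : R) : smooth f ->
  is_derive s 1 (derive1n m f) (derive1n m.+1 f s).
Proof. by move=> fs; rewrite derive1nS derive1E; apply/derivableP/fs. Qed.

Lemma prof_derivatives (R : realType) (f1 f2 : R -> R) :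
  smooth f1 -> smooth f2 -> (forall s, f1 s ^+ 2 + f2 s ^+ 2 < 1) ->
  exists dr d2r : R -> R,
    (forall s : R, is_derive s 1 (prof f1 f2) (dr s)) /\ (forall s : R, is_derive s 1 dr (d2r s)).
Proof.
move=> s1 s2 lt1.
have arg0 s : 0 < 1 - f1 s ^+ 2 - f2 s ^+ 2 by rewrite -addrA -opprD subr_gt0.
have prof0 s : prof f1 f2 s != 0 by rewrite gt_eqF // sqrtr_gt0.
pose df1 : R -> R := derive1n 1 f1; pose df2 : R -> R := derive1n 1 f2.
have D1 (s : R) : is_derive s 1 f1 (df1 s) by exact: (smooth_is_derive 0).
have D2 (s : R) : is_derive s 1 f2 (df2 s) by exact: (smooth_is_derive 0).
have D12 (s : R) : is_derive s 1 df1 (derive1n 2 f1 s) by exact: (smooth_is_derive 1).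
have D22 (s : R) : is_derive s 1 df2 (derive1n 2 f2 s) by exact: (smooth_is_derive 1).
pose num (s : R) : R := - (f1 s * df1 s + f2 s * df2 s).
exists (fun s => num s * prof f1 f2 s ^- 1).
have Dprof (s : R) : is_derive s 1 (prof f1 f2) (num s * prof f1 f2 s ^- 1).
  have Darg : is_derive s 1 (fun s => 1 - f1 s ^+ 2 - f2 s ^+ 2)
      (0 - (df1 s * f1 s + f1 s * df1 s) - (df2 s * f2 s + f2 s * df2 s)).
    apply: is_deriveB; last by apply: is_derive_mul.
    by apply: is_deriveB; apply: is_derive_mul.
  have Dc := is_derive_compR (t := fun s => 1 - f1 s ^+ 2 - f2 s ^+ 2) (is_derive1_sqrt (arg0 s)) Darg.
  apply: (is_derive_eq Dc).
  rewrite -[Num.sqrt _]/(prof f1 f2 s) /num expr1; by field.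
have Dnum (s : R) : is_derive s 1 num (- ((df1 s * df1 s + f1 s * derive1n 2 f1 s) + (df2 s * df2 s + f2 s * derive1n 2 f2 s))).
  by apply: is_deriveN; apply: is_deriveD; apply: is_derive_mul.
exists (fun s => - ((df1 s * df1 s + f1 s * derive1n 2 f1 s) + (df2 s * df2 s + f2 s * derive1n 2 f2 s))
    * prof f1 f2 s ^- 1 + num s * - (1%:R * (num s * prof f1 f2 s ^- 1) / prof f1 f2 s * prof f1 f2 s ^- 1)).
split=> // s; apply: is_derive_mul => //.
exact: is_derive_powV.
Qed.

Theorem theorem2p2 (R : realType) (k l n : nat) (T : R) (f1 f2 : R -> R)
    (hk : (1 <= k)%N) (hl : (1 <= l)%N) (hn : n = (k + l + 1)%N)
    (hT : 0 < T)
    (f1_smooth : smooth f1) (f2_smooth : smooth f2)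
    (f1_periodic : periodic f1 T) (f2_periodic : periodic f2 T)
    (f2_pos : forall t : R, 0 < f2 t)
    (f12_lt1 : forall t : R, f1 t ^+ 2 + f2 t ^+ 2 < 1)
    (phi_minimal : minimal_immersion n (@sphere_product R k l)
                     (@rot_map R k l f1 f2))
    (i : 'I_k.+1) (j : 'I_l.+1)
    (U : set 'rV[R]_n)
    (p : 'rV[R]_n -> ('rV[R]_k.+1 * 'rV[R]_l.+1 * R)%type)
    (hp : local_param (@sphere_product R k l) U p)
    (x : 'rV[R]_n) (hx : U x) :
  stability_operator (@rot_map R k l f1 f2 \o p)
      (@zeta R k l f1 f2 i j \o p) x
  = - n%:R * @zeta R k l f1 f2 i j (p x).
Proof.
have [Xs /(_ x hx)[_ inj H0]] := phi_minimal U p hp.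
have [oU ps pM _] := hp.
have [dr [d2r [Dr D2r]]] := prof_derivatives f1_smooth f2_smooth f12_lt1.
have arg0 s : 0 < 1 - f1 s ^+ 2 - f2 s ^+ 2 by rewrite -addrA -opprD subr_gt0.
pose y w := (p w).1.1; pose z w := (p w).1.2; pose t w := (p w).2.
have XE : @rot_map R k l f1 f2 \o p = rotX y z t (prof f1 f2) f2 f1.
  by rewrite funeqE => w; rewrite /rotX /y /z /t /=; case: (p w) => [[]].
have uE : @zeta R k l f1 f2 i j \o p =
    (fun w => rpow (prof f1 f2) f2 k l (t w) * y w 0 i * z w 0 j).
  by rewrite funeqE => w; rewrite /y /z /t /=; case: (p w) => [[]].
rewrite -[zeta _ _ _ _ _]/((@zeta R k l f1 f2 i j \o p) x) uE; rewrite XE in Xs inj H0 *.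
have D1 a w : U w -> _ := fun Uw => smooth_on_is_derive ps a Uw.
have D2 a b w : U w -> _ := fun Uw => smooth_on_is_derive (smooth_on_partial ps b) a Uw.
have rsph s : prof f1 f2 s ^+ 2 + f2 s ^+ 2 + f1 s ^+ 2 = 1.
  by rewrite /prof sqr_sqrtr ?ltW // subrK subrK.
refine (@stability_rotX R n k l hn U oU y (fun a w => (partial a p w).1.1)
  (fun a b w => (partial a (partial b p) w).1.1)
  z (fun a w => (partial a p w).1.2) (fun a b w => (partial a (partial b p) w).1.2)
  t (fun a w => (partial a p w).2) (fun a b w => (partial a (partial b p) w).2)
  (prof f1 f2) dr d2r f2 (derive1n 1 f2) (derive1n 2 f2)
  f1 (derive1n 1 f1) (derive1n 2 f1)
  _ _ _ _ _ _ _ _ Dr D2r _ _ _ _ _ _ rsph Xs x hx inj i j H0).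
- by move=> w /pM[].
- by move=> w /pM[].
- by move=> a w Uw; have [D _] := is_derive_pair (D1 a w Uw); have [] := is_derive_pair D.
- by move=> a b w Uw; have [D _] := is_derive_pair (D2 a b w Uw); have [] := is_derive_pair D.
- by move=> a w Uw; have [D _] := is_derive_pair (D1 a w Uw); have [] := is_derive_pair D.
- by move=> a b w Uw; have [D _] := is_derive_pair (D2 a b w Uw); have [] := is_derive_pair D.
- by move=> a w Uw; have [] := is_derive_pair (D1 a w Uw).
- by move=> a b w Uw; have [] := is_derive_pair (D2 a b w Uw).
- by move=> s; apply: (smooth_is_derive 0).
- by move=> s; apply: (smooth_is_derive 1).
- by move=> s; apply: (smooth_is_derive 0).
- by move=> s; apply: (smooth_is_derive 1).
- by move=> s; rewrite gt_eqF // sqrtr_gt0.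
- by move=> s; rewrite gt_eqF.
Qed.
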